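(* Let $q\geq 2$ be an integer, and let $Z$ be an element of the $q$th Wiener chaos $\mathcal{H}_q$ of $X$. Assume that $\mathrm{Var}(Z)=E(Z^2)=1$, and let $N\sim\mathscr{N}(0,1)$. Then, for every integer $k\geq 3$, $$\big|E(Z^k)-E(N^k)\big|\leq c_{k,q}\sqrt{E(Z^4)-E(N^4)},$$ where the constant $c_{k,q}$ is given by $$c_{k,q}=(k-1)\,2^{k-\frac52}\sqrt{\frac{q-1}{3q}}\left(\sqrt{\frac{(2k-4)!}{2^{k-2}(k-2)!}}+(2k-5)^{\frac{kq}{2}-q}\right).$$
   Context: $\mathfrak{H}$ is a real separable Hilbert space and $X=\{X(h):h\in\mathfrak{H}\}$ is an isonormal Gaussian process over $\mathfrak{H}$: a centered Gaussian family on a probability space $(\Omega,\mathcal{F},P)$ with $E[X(g)X(h)]=\langle g,h\rangle_{\mathfrak{H}}$ for all $g,h\in\mathfrak{H}$, where $\mathcal{F}$ is generated by $X$. For $q\geq 1$, the $q$th Wiener chaos $\mathcal{H}_q$ of $X$ is the closed linear subspace of $L^2(\Omega,\mathcal{F},P)$ generated by the random variables $H_q(X(h))$, $h\in\mathfrak{H}$, $\|h\|_{\mathfrak{H}}=1$, where $H_q(x)=(-1)^q e^{x^2/2}\frac{d^q}{dx^q}e^{-x^2/2}$ is the $q$th Hermite polynomial. $\mathscr{N}(0,1)$ is the standard Gaussian distribution. *)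

(* Defs.v *)
From HB Require Import structures.
From mathcomp Require Import all_boot all_order all_algebra.
From mathcomp Require Import all_classical all_reals all_analysis.
Set Implicit Arguments.
Unset Strict Implicit.
Unset Printing Implicit Defensive.
Import Order.TTheory GRing.Theory Num.Theory.
Import numFieldNormedType.Exports.
Local Open Scope classical_set_scope.
Local Open Scope ring_scope.

Definition separable (T : topologicalType) : Prop :=
  exists2 D : set T, countable D & dense D.

(* Laws are compared on measurable sets only: the values of a library measure
   outside its sigma-algebra carry no information. *)
Definition has_law (R : realType) (d : measure_display)
    (Omega : measurableType d) (P : probability Omega R)
    (Y : {RV P >-> R}) (mu : set R -> \bar R) : Prop :=
  forall A : set R, measurable A -> distribution P Y A = mu A.

(* N(0, s^2), degenerate case included; [normal_prob 0 0] is by convention the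
   uniform law on [0, 1], not the Dirac mass. *)
Definition centered_normal (R : realType) (s : R) : set R -> \bar R :=
  if s == 0 then dirac (0 : R) else normal_prob 0 s.

Definition centered_gaussian_family (R : realType) (d : measure_display)
    (Omega : measurableType d) (P : probability Omega R) (I : Type)
    (X : I -> {RV P >-> R}) : Prop :=
  forall (n : nat) (i : 'I_n -> I) (a : 'I_n -> R),
    exists s : R,
      has_law (P := P) (\sum_(j < n) a j *: (X (i j) : {mfun Omega >-> R}))
        (centered_normal s).

Record isonormal (R : realType) (H : completeNormedModType R)
    (dot : {dot H for idfun}) (d : measure_display)
    (Omega : measurableType d) (P : probability Omega R)
    (X : H -> {RV P >-> R}) : Prop := {
  isonormal_gaussian : centered_gaussian_family X;
  isonormal_covariance :
    forall g h : H, ('E_P[X g \* X h] = (dot g h)%:E)%E;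
  isonormal_generated :
    (measurable : set (set Omega)) =
      <<s \bigcup_(h in [set: H])
            preimage_set_system [set: Omega] (X h) measurable >>
}.

Definition hermite (R : realType) (q : nat) (x : R) : R :=
  (-1) ^+ q * expR (x ^+ 2 / 2) *
  derive1n q (fun y : R => expR (- (y ^+ 2 / 2))) x.

(* The L^2-closure of the linear span of the H_q(X(h)), |h| = 1; its elements
   are represented by square-integrable functions rather than by classes modulo
   almost-sure equality. *)
Definition wiener_chaos (R : realType) (H : completeNormedModType R)
    (d : measure_display) (Omega : measurableType d) (P : probability Omega R)
    (X : H -> {RV P >-> R}) (q : nat) : set (Omega -> R) :=
  [set Z | Z \in Lfun P 2%:E /\
    forall e : R, 0 < e ->
      exists (n : nat) (a : 'I_n -> R) (h : 'I_n -> H),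
        (forall i, `|h i| = 1) /\
        ('N[P]_2%:E[EFin \o (fun w =>
            Z w - \sum_(i < n) a i * hermite q (X (h i) w))%R] < e%:E)%E].

(* Meant for k >= 3, where the truncated subtractions are exact; the exponents
   k - 5/2 and kq/2 - q need not be integers, whence [powR]. *)
Definition moment_constant (R : realType) (k q : nat) : R :=
  (k%:R - 1) * 2 `^ (k%:R - 5 / 2) * Num.sqrt ((q%:R - 1) / (3 * q%:R)) *
  (Num.sqrt ((2 * k - 4)`!%:R / (2 ^+ (k - 2) * (k - 2)`!%:R))
   + (2 * k%:R - 5) `^ (k%:R * q%:R / 2 - q%:R)).

(* Main.v *)
(** An element of the [q]-th chaos is an L^2-limit of polynomials [p] in finitely
    many Gaussian variables, and for these everything follows from the Gaussian
    integration by parts [j E[g p] = E <nabla g, nabla p>] for [p] in chaos [j].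

    Moments.  With [G = |nabla p|^2] and [E p^2 = 1], taking [g = p^(k-1)] gives
    [E p^k = (k-1) E[p^(k-2) G/q]], hence
    [E p^k - (k-1) E p^(k-2) = (k-1) E[p^(k-2) (G/q - 1)]].  As the Gaussian
    moments satisfy the recursion without right-hand side, the gap of order [k]
    is controlled, by induction and Cauchy-Schwarz, by [E p^(2k-4)] and by
    [E (G/q - 1)^2].

    Variance.  [p^2] is a sum of components [W_r] of chaos order [2q - 2r], and
    [G = \sum_r r W_r].  So [E (G/q - 1)^2 = \sum_(r<q) (r/q)^2 E W_r^2], while
    [E p^4 - 3 = (3/q) \sum_(r<q) r E W_r^2]; the ratio is at most [(q-1)/(3q)].

    Hypercontractivity.  For a vector [F] in chaos [q], integration by parts,
    Cauchy-Schwarz and Young give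
    [E |F|^(2m) <= ((2m-1)/q)^m E |nabla F|^(2m)].  Since [nabla F] is in chaos
    [q-1], iterating yields Nelson's bound [(2m-1)^(qm) (E |F|^2)^m]. *)

Require Import Defs.
From HB Require Import structures.
From mathcomp Require Import all_boot all_order all_algebra.
From mathcomp Require Import all_classical all_reals all_analysis.
From mathcomp Require Import measurable_realfun.
From mathcomp Require mpoly.
Import -(notations) mpoly.
From mathcomp Require Import ring lra zify.
Import Order.TTheory GRing.Theory Num.Theory.
Import numFieldNormedType.Exports.
Local Open Scope classical_set_scope.
Local Open Scope ring_scope.
Set Implicit Arguments.
Unset Strict Implicit.
Unset Printing Implicit Defensive.

(** * Elementary inequalities *)

(** The vectors [h i] of an approximant are in general neither orthogonal nor independent. So the
    algebra is done on formal polynomials, and the covariance enters only through a factorization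
    [A^T A] of the Gram matrix: ['X_i] stands for [\sum_b A b i xi_b] with independent standard
    [xi_b], and the gradient is taken in the [xi_b]. The expectation is an abstract positive linear
    functional with integration by parts. That formula is deduced from the laws of the linear
    combinations alone: their moments fix the functional on powers of linear forms, hence by
    polarization everywhere.

    L^2 convergence says nothing about moments beyond the second. Nelson's bound, uniform over unit
    elements, reaches [Z] by truncation and monotone convergence; then the moments of unit
    approximants converge to those of [Z] and the inequality passes to the limit.

    In the induction on [k] the factor [k - 1] picked up at each step is absorbed by the growth of
    Nelson's bound, so that only a power of 2 accumulates. *)

Lemma discriminant_le (R : realFieldType) (a b c : R) :
  (forall t, 0 <= a + 2 * b * t + c * t ^+ 2) -> b ^+ 2 <= a * c.
Proof.
move=> h.
have a0 : 0 <= a by move: (h 0); rewrite expr0n /= !mulr0 !addr0.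
have [c0|c0] := eqVneq c 0; last first.
  have c_gt0 : 0 < c.
    rewrite lt_neqAle eq_sym c0 leNgt; apply/negP => cn.
    have bc : 0 <= a + 1 + b ^+ 2 - c by have := sqr_ge0 b; lra.
    (* Chosen so that [c * t ^+ 2] is [- 2 * (a + 1 + b ^+ 2 - c) * t], which beats [a + 2 * b * t]
       once [t >= 2]. *)
    pose t := 2 * (a + 1 + b ^+ 2 - c) / (- c).
    have := h t; have ct : c * t = - (2 * (a + 1 + b ^+ 2 - c)).
      by rewrite /t; field.
    have -> : c * t ^+ 2 = (c * t) * t by ring.
    have t2 : 2 <= t by rewrite /t ler_pdivlMr; have := sqr_ge0 b; lra.
    rewrite ct => H.
    have : b * t <= (1 + b ^+ 2) * t / 2 + b ^+ 2 * t / 2.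
      have := sqr_ge0 (b - 1); nra.
    nra.
  have := h (- b / c).
  have -> : a + 2 * b * (- b / c) + c * (- b / c) ^+ 2 = (a * c - b ^+ 2) / c by field.
  by rewrite pmulr_lge0 ?invr_gt0// subr_ge0.
rewrite c0 mulr0; have [->|b0] := eqVneq b 0; first by rewrite expr0n.
have := h (- (a + 1) / (2 * b)); rewrite c0 mul0r addr0.
have -> : a + 2 * b * (- (a + 1) / (2 * b)) = -1 by field.
lra.
Qed.

Lemma sum_CauchySchwarz (R : realFieldType) (I : finType) (f g : I -> R) :
  (\sum_i f i * g i) ^+ 2 <= (\sum_i f i ^+ 2) * (\sum_i g i ^+ 2).
Proof.
apply: discriminant_le => t.
have -> : \sum_i f i ^+ 2 + 2 * (\sum_i f i * g i) * t
    + (\sum_i g i ^+ 2) * t ^+ 2 = \sum_i (f i + t * g i) ^+ 2.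
  rewrite -mulrA mulr_suml mulr_sumr mulr_suml -!big_split /=.
  by apply: eq_bigr => i _; ring.
by apply: sumr_ge0 => i _; exact: sqr_ge0.
Qed.

Lemma young_pow (R : realFieldType) (m : nat) (a b : R) : 0 <= a -> 0 <= b ->
  m.+1%:R * (a ^+ m * b) <= m%:R * a ^+ m.+1 + b ^+ m.+1.
Proof.
move=> a0 b0; elim: m => [|m IH]; first by rewrite expr0 mul0r add0r !mul1r expr1.
(* Exactly the gap between the goal and [a] times the induction hypothesis. *)
have key : 0 <= (b - a) * (b ^+ m.+1 - a ^+ m.+1).
  rewrite subrXX mulrA -expr2 mulr_ge0 ?sqr_ge0// sumr_ge0// => i _.
  by rewrite mulr_ge0 ?exprn_ge0.
have := ler_wpM2l a0 IH.
rewrite !exprS in key *.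
rewrite -(addn1 m.+1) -(addn1 m) !natrD.
move: key; set u := a ^+ m; set v := b ^+ m => key H.
by nra.
Qed.

(** * Chaos decomposition of polynomials *)

Section GaussianPolynomials.
Variables (R : realFieldType) (n m : nat) (A : 'I_m -> 'I_n -> R).
Local Notation poly := (mpoly n R).
Local Notation "''X_' i" := (mpolyX R (mnm1 i) : poly).

(** The derivative in the direction of [xi_b], when ['X_i] is read as [\sum_b A b i xi_b]. *)
Definition nabla (b : 'I_m) (p : poly) : poly := \sum_i A b i *: mderiv i p.

(** With the covariance matrix [C = A^T A], this is [\sum_j C i j d/dX_j], the operator paired with
    multiplication by ['X_i] in Gaussian integration by parts. *)
Definition delta (i : 'I_n) (p : poly) : poly := \sum_b A b i *: nabla b p.

Fact nabla_linear b : linear (nabla b).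
Proof.
move=> c p q; rewrite /nabla scaler_sumr -big_split /=; apply: eq_bigr => i _.
by rewrite linearP /= scalerDr !scalerA [c * _]mulrC.
Qed.
HB.instance Definition _ b :=
  GRing.isLinear.Build R poly poly _ (nabla b) (nabla_linear b).

Fact delta_linear i : linear (delta i).
Proof.
move=> c p q; rewrite /delta scaler_sumr -big_split /=; apply: eq_bigr => b _.
by rewrite linearP /= scalerDr !scalerA [c * _]mulrC.
Qed.
HB.instance Definition _ i :=
  GRing.isLinear.Build R poly poly _ (delta i) (delta_linear i).

Lemma nablaM b p q : nabla b (p * q) = nabla b p * q + p * nabla b q.
Proof.
rewrite /nabla mulr_suml mulr_sumr -big_split /=; apply: eq_bigr => i _.
by rewrite mderivM scalerDr scalerAl scalerAr.
Qed.

Lemma deltaM i p q : delta i (p * q) = delta i p * q + p * delta i q.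
Proof.
rewrite /delta mulr_suml mulr_sumr -big_split /=; apply: eq_bigr => b _.
by rewrite nablaM scalerDr scalerAl scalerAr.
Qed.

Lemma nabla1 b : nabla b 1 = 0.
Proof.
by rewrite /nabla big1// => i _; rewrite -mpolyC1 mderivC scaler0.
Qed.

Lemma nablaC b c : nabla b (mpolyC n c) = 0.
Proof. by rewrite /nabla big1// => i _; rewrite mderivC scaler0. Qed.

Lemma nablaXn b p k : nabla b (p ^+ k.+1) = k.+1%:R *: (p ^+ k * nabla b p).
Proof.
elim: k => [|k IH]; first by rewrite expr0 mul1r scale1r.
rewrite exprS nablaM IH -scalerAr mulrA -exprS [nabla b p * _]mulrC.
by rewrite -[in RHS]natr1 addrC scalerDl scale1r.
Qed.

Lemma mderivXU i j : mderiv i 'X_j = mpolyC n (i == j)%:R.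
Proof.
rewrite mderivX mnmE eq_sym; case: eqP => [->|_]; last by rewrite scale0r mpolyC0.
have -> : mnm_sub (mnm1 j) (mnm1 j) = mnm0 by apply/mnmP => k; rewrite !mnmE subnn.
by rewrite scale1r mpolyX0 mpolyC1.
Qed.

Lemma nablaX b i : nabla b 'X_i = mpolyC n (A b i).
Proof.
rewrite /nabla (bigD1 i)//= mderivXU eqxx big1 ?addr0 => [|k /negbTE ki].
  by rewrite mpolyC1 -alg_mpolyC.
by rewrite mderivXU ki mpolyC0 scaler0.
Qed.

Lemma nablaC_comm b c p : nabla b (nabla c p) = nabla c (nabla b p).
Proof.
rewrite /nabla; under eq_bigr => i _ do rewrite (raddf_sum (mderiv i)) scaler_sumr.
under [RHS]eq_bigr => i _ do rewrite (raddf_sum (mderiv i)) scaler_sumr.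
rewrite exchange_big /=; apply: eq_bigr => i _; apply: eq_bigr => j _.
by rewrite !mderivZ !scalerA mderiv_comm mulrC.
Qed.

Lemma delta_nabla i b p : delta i (nabla b p) = nabla b (delta i p).
Proof.
rewrite /delta raddf_sum /=; apply: eq_bigr => c _.
by rewrite linearZ /= nablaC_comm.
Qed.

(* The [j]-th Wiener chaos of polynomials: [p |-> 'X_i * p - delta i p] is the
   creation operator, adjoint to [delta i] under the Gaussian expectation. *)
Inductive chaos : nat -> poly -> Prop :=
| chaosC c : chaos 0 (mpolyC n c)
| chaos_create j i p : chaos j p -> chaos j.+1 ('X_i * p - delta i p)
| chaos0 j : chaos j 0
| chaosP j c p q : chaos j p -> chaos j q -> chaos j (c *: p + q).

Lemma chaosZ j c p : chaos j p -> chaos j (c *: p).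
Proof. by move=> h; rewrite -[_ *: _]addr0; apply: chaosP => //; exact: chaos0. Qed.

Lemma chaosD j p q : chaos j p -> chaos j q -> chaos j (p + q).
Proof. by move=> hp hq; rewrite -[p]scale1r; exact: chaosP. Qed.

Lemma chaos_sum j (I : Type) (r : seq I) (P : pred I) (F : I -> poly) :
  (forall i, P i -> chaos j (F i)) -> chaos j (\sum_(i <- r | P i) F i).
Proof. by move=> h; apply: big_ind => //; [exact: chaos0|exact: chaosD]. Qed.

Lemma chaos0_const p : chaos 0 p -> exists c, p = mpolyC n c.
Proof.
move: {2 3}0%N (erefl 0%N) => j j0 h; elim: h j0 => // {j p}.
- by move=> c _; exists c.
- by move=> j _; exists 0; rewrite mpolyC0.
- move=> j c p q _ IHp _ IHq j0.
  have [cp ->] := IHp j0; have [cq ->] := IHq j0.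
  by exists (c * cp + cq); rewrite mpolyCD mpolyCM mul_mpolyC.
Qed.

(** Commuting [nabla b] past the creation operator leaves [A b i *: p] plus the creation operator
    applied to [nabla b p]. Order 0 belongs to the same induction, since creation from a constant
    relies on its gradient being 0. *)
Lemma chaos_nabla_pred b j p : chaos j p ->
  if j is j'.+1 then chaos j' (nabla b p) else nabla b p = 0.
Proof.
elim=> {j p}.
- by move=> c; rewrite nablaC.
- move=> j i p hp IH; rewrite linearB /= nablaM nablaX mul_mpolyC.
  rewrite -delta_nabla -addrA.
  case: j hp IH => [|j] hp IH; last by apply: chaosP => //; exact: chaos_create.
  by rewrite IH linear0 mulr0 subr0 addr0; exact: chaosZ.
- by case=> [|j]; rewrite linear0//; exact: chaos0.
- move=> [|j] c p q _ IHp _ IHq; rewrite linearP /=.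
    by rewrite IHp IHq scaler0 addr0.
  exact: chaosP.
Qed.

Lemma chaos_nabla b j p : chaos j.+1 p -> chaos j (nabla b p).
Proof. by move/(chaos_nabla_pred b). Qed.

Lemma chaos_delta i j p : chaos j.+1 p -> chaos j (delta i p).
Proof. by move=> h; apply: chaos_sum => b _; apply/chaosZ/chaos_nabla. Qed.

Lemma delta_chaos0 i p : chaos 0 p -> delta i p = 0.
Proof.
by move=> h; rewrite /delta big1// => b _; rewrite (chaos_nabla_pred b h) scaler0.
Qed.

(* Sums of chaoses of order [d], [d - 2], [d - 4], and so on. *)
Inductive even_chaoses : nat -> poly -> Prop :=
| even_chaoses_chaos j r p : chaos j p -> even_chaoses (j + r.*2) p
| even_chaosesP d c p q :
    even_chaoses d p -> even_chaoses d q -> even_chaoses d (c *: p + q).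

(** ['X_i * p] is creation plus [delta i p]: one order up plus one order down, so the parity is
    kept. *)
Lemma even_chaosesX d i p : even_chaoses d p -> even_chaoses d.+1 ('X_i * p).
Proof.
elim=> {d p} [j r p hp|d c p q _ IHp _ IHq]; last first.
  by rewrite mulrDr -scalerAr; exact: even_chaosesP.
rewrite -['X_i * p](subrK (delta i p)) -[_ - _]scale1r; apply: even_chaosesP.
  by rewrite -addSn; apply: even_chaoses_chaos; exact: chaos_create.
case: j hp => [|j] hp.
  rewrite (delta_chaos0 i hp) -addSn.
  exact: even_chaoses_chaos (chaos0 _).
rewrite -addSn !addSnnS -doubleS.
by apply: even_chaoses_chaos; exact: chaos_delta.
Qed.

Lemma even_chaosesZ d c p : even_chaoses d p -> even_chaoses d (c *: p).
Proof.
move=> h; have -> : c *: p = (c - 1) *: p + p by rewrite scalerBl scale1r subrK.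
exact: even_chaosesP.
Qed.

Lemma even_chaosesSS d p : even_chaoses d p -> even_chaoses d.+2 p.
Proof.
elim=> {d p} [j r p hp|d c p q _ IHp _ IHq]; last exact: even_chaosesP.
by rewrite -!addnS -doubleS; exact: even_chaoses_chaos.
Qed.

Lemma even_chaoses_decomp q p : even_chaoses q.*2 p ->
  exists2 W : nat -> poly, p = \sum_(r < q.+1) W r &
    forall r, (r <= q)%N -> chaos (q - r).*2 (W r).
Proof.
move: {-2}q.*2 (erefl q.*2) => d dq h; elim: h dq => {d p} [j r p hp|d c p s _ IHp _ IHs] dq.
  have rq : (r <= q)%N by lia.
  exists (fun r' => if r' == r then p else 0).
    rewrite (bigD1 (inord r)) //= inordK ?ltnS// eqxx big1 ?addr0// => k.
    have [kr|//] := eqVneq (k : nat) r.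
    by rewrite -val_eqE /= inordK ?ltnS// kr eqxx.
  move=> r' r'q; case: eqP => [->|_]; last exact: chaos0.
  by rewrite (_ : (q - r).*2 = j)//; lia.
have [W -> hW] := IHp dq; have [V -> hV] := IHs dq.
exists (fun r => c *: W r + V r); first by rewrite big_split /= scaler_sumr.
by move=> r rq; apply: chaosP; [exact: hW|exact: hV].
Qed.

(** * Hermite polynomials of the variables and their products *)

Fixpoint hermite_var (i : 'I_n) (k : nat) : poly :=
  match k with
  | 0 => 1
  | k'.+1 => if k' is k''.+1 then
      'X_i * hermite_var i k' - k'%:R *: hermite_var i k'' else 'X_i
  end.

Lemma hermite_varSS i k : hermite_var i k.+2 =
  'X_i * hermite_var i k.+1 - k.+1%:R *: hermite_var i k.
Proof. by []. Qed.

Lemma hermite_var0 i : hermite_var i 0 = 1. Proof. by []. Qed.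

Lemma hermite_var1 i : hermite_var i 1 = 'X_i. Proof. by []. Qed.

Local Arguments hermite_var : simpl never.

Lemma nabla_hermite_var b i k :
  nabla b (hermite_var i k.+1) = (k.+1%:R * A b i) *: hermite_var i k.
Proof.
elim/ltn_ind: k => -[_|[|k] IH].
- by rewrite hermite_var0 hermite_var1 nablaX mul1r -alg_mpolyC.
- rewrite hermite_varSS hermite_var0 hermite_var1 linearB linearZ /= nablaM.
  rewrite nabla1 nablaX scaler0 subr0 [_ * mpolyC _ _]mulrC mul_mpolyC.
  rewrite -scalerDl -mulr2n; congr (_ *: _).
  by rewrite mulr_natl.
- rewrite hermite_varSS linearB linearZ /= nablaM nablaX (IH k)// (IH k.+1)//.
  by rewrite hermite_varSS -!mul_mpolyC !mpolyCM !mpolyC_nat; ring.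
Qed.

(** For unit variance [delta i] sends the polynomial of degree [k + 1] to [k + 1] times that of
    degree [k], so the three-term recursion is the creation operator. *)
Lemma chaos_hermite_var i k : \sum_b A b i ^+ 2 = 1 -> chaos k (hermite_var i k).
Proof.
move=> Ci; elim/ltn_ind: k => -[_|[|k] IH].
- by rewrite hermite_var0 -mpolyC1; exact: chaosC.
- have := chaos_create i (chaosC 1).
  by rewrite hermite_var1 mpolyC1 mulr1 /delta big1 ?subr0// => b _; rewrite nabla1 scaler0.
- rewrite hermite_varSS; have := chaos_create i (IH k.+1 (ltnSn _)).
  congr (chaos _ (_ - _)); rewrite /delta.
  under eq_bigr do rewrite nabla_hermite_var scalerA mulrCA -expr2.
  by rewrite -scaler_suml -mulr_sumr Ci mulr1.
Qed.

(** Only the top order and the parity of the product are tracked: the fourth-moment argument never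
    looks at the coefficients of its components. *)
Lemma even_chaoses_hermite_varM i k d p :
  even_chaoses d p -> even_chaoses (k + d) (hermite_var i k * p).
Proof.
elim/ltn_ind: k => -[_|[|k] IH] hp.
- by rewrite hermite_var0 mul1r.
- exact: even_chaosesX.
- rewrite hermite_varSS mulrBl -mulrA addrC -scalerAl -scaleNr.
  apply: even_chaosesP; last by rewrite addSn; apply: even_chaosesX; exact: IH.
  by rewrite !addSn; apply: even_chaosesSS; exact: IH.
Qed.

Lemma even_chaoses_hermite_sqr (I : finType) (c : I -> R) (f : I -> 'I_n) k :
  even_chaoses k.*2 ((\sum_i c i *: hermite_var (f i) k) ^+ 2).
Proof.
have sumP d (J : finType) (F : J -> poly) :
    (forall j, even_chaoses d.*2 (F j)) -> even_chaoses d.*2 (\sum_j F j).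
  move=> h; apply: (big_ind (even_chaoses d.*2)) => //.
    by rewrite -[d.*2]add0n; apply: even_chaoses_chaos; exact: chaos0.
  by move=> x y hx hy; rewrite -[x]scale1r; exact: even_chaosesP.
rewrite expr2 mulr_suml; apply: (sumP) => i; rewrite mulr_sumr; apply: (sumP) => j.
rewrite -scalerAl -scalerAr; do 2! apply: even_chaosesZ.
rewrite -addnn; apply: even_chaoses_hermite_varM.
rewrite -[hermite_var (f j) k]mulr1 -[k in even_chaoses k]addn0.
apply: even_chaoses_hermite_varM; rewrite -mpolyC1.
by have := even_chaoses_chaos 0 (chaosC 1).
Qed.

End GaussianPolynomials.

Arguments hermite_var : simpl never.

(** * Hypercontractivity and the fourth moment *)

Fixpoint normal_moment (R : pzSemiRingType) (k : nat) : R :=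
  match k with
  | 0 => 1
  | 1 => 0
  | k'.+2 => k'.+1%:R * normal_moment R k'
  end.

Section GaussianExpectation.
Variables (R : realType) (n m : nat) (A : 'I_m -> 'I_n -> R).
Local Notation poly := (mpoly n R).
Local Notation "''X_' i" := (mpolyX R (mnm1 i) : poly).
Local Notation nabla := (nabla A).
Local Notation delta := (delta A).
Local Notation chaos := (chaos A).

(** Keeping the expectation abstract frees this section from every integrability question. *)
Variable E : poly -> R.
Hypothesis E_lin : forall c p q, E (c *: p + q) = c * E p + E q.
Hypothesis E1 : E 1 = 1.
Hypothesis E_ge0 : forall p, (forall v, 0 <= meval v p) -> 0 <= E p.
Hypothesis E_ibp : forall i p, E ('X_i * p) = E (delta i p).

Let ED p q : E (p + q) = E p + E q.
Proof. by rewrite -[p in LHS]scale1r E_lin mul1r. Qed.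

Let E0 : E 0 = 0.
Proof. by apply: (@addrI _ (E 0)); rewrite -ED !addr0. Qed.

Let EZ c p : E (c *: p) = c * E p.
Proof. by rewrite -[c *: p]addr0 E_lin E0 addr0. Qed.

Let EN p : E (- p) = - E p.
Proof. by rewrite -scaleN1r EZ mulN1r. Qed.

Let EB p q : E (p - q) = E p - E q.
Proof. by rewrite ED EN. Qed.

Let Esum (I : Type) (r : seq I) (P : pred I) (F : I -> poly) :
  E (\sum_(i <- r | P i) F i) = \sum_(i <- r | P i) E (F i).
Proof. exact: (big_morph _ ED E0). Qed.

Let E_mono p q : (forall v, meval v p <= meval v q) -> E p <= E q.
Proof.
by move=> h; rewrite -subr_ge0 -EB; apply: E_ge0 => v; rewrite mevalB subr_ge0.
Qed.

Let EC c : E (mpolyC n c) = c.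
Proof. by rewrite -alg_mpolyC EZ E1 mulr1. Qed.

Lemma expectation_CauchySchwarz p q : E (p * q) ^+ 2 <= E (p ^+ 2) * E (q ^+ 2).
Proof.
apply: discriminant_le => t.
have -> : E (p ^+ 2) + 2 * E (p * q) * t + E (q ^+ 2) * t ^+ 2
        = E ((p + t *: q) ^+ 2).
  have -> : (p + t *: q) ^+ 2 = p ^+ 2 + (2 * t) *: (p * q) + (t ^+ 2) *: (q ^+ 2).
    rewrite -!mul_mpolyC mpolyCM [t ^+ 2]expr2 mpolyCM mpolyC_nat; ring.
  by rewrite !ED !EZ; ring.
by apply: E_ge0 => v; rewrite rmorphXn sqr_ge0.
Qed.

(** Chaos [j] is an eigenspace of the number operator. By adjointness, creation moves onto [g] as
    [delta i g]; commuting [nabla] with creation releases one more [E (delta i g * p)], which raises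
    the eigenvalue by 1. The induction hypothesis is used at [delta i g], whence the generality in
    [g]. *)
Lemma chaos_dirichlet j p g : chaos j p ->
  j%:R * E (g * p) = \sum_b E (nabla b g * nabla b p).
Proof.
move=> h; elim: h g => {j p}.
- by move=> c g; rewrite mul0r big1// => b _; rewrite nablaC mulr0 E0.
- move=> j i p hp IH g.
  have ibp f h : E (f * ('X_i * h - delta i h)) = E (delta i f * h).
    rewrite mulrBr mulrCA EB E_ibp deltaM ED; ring.
  rewrite ibp.
  have -> : \sum_b E (nabla b g * nabla b ('X_i * p - delta i p)) =
     \sum_b (A b i * E (nabla b g * p) + E (nabla b (delta i g) * nabla b p)).
    apply: eq_bigr => b _; rewrite linearB /= nablaM nablaX mul_mpolyC.
    by rewrite -delta_nabla -addrA mulrDr ED ibp -scalerAr EZ delta_nabla.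
  rewrite big_split /= -IH -natr1 mulrDl mul1r addrC; congr (_ + _).
  rewrite /(delta) mulr_suml Esum; apply: eq_bigr => b _.
  by rewrite -scalerAl EZ.
- by move=> j g; rewrite mulr0 E0 mulr0 big1// => b _; rewrite linear0 mulr0 E0.
- move=> j c p q _ IHp _ IHq g.
  rewrite mulrDr -scalerAr E_lin mulrDr mulrCA IHp IHq mulr_sumr -big_split /=.
  by apply: eq_bigr => b _; rewrite linearP /= mulrDr -scalerAr E_lin.
Qed.

(** The Dirichlet form is symmetric, so [E (p * q)] is multiplied by [j] and by [k] with the same
    result. *)
Lemma chaos_orthogonal j k p q : chaos j p -> chaos k q -> j != k -> E (p * q) = 0.
Proof.
move=> hp hq jk.
have e1 := chaos_dirichlet q hp; have e2 := chaos_dirichlet p hq.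
have : j%:R * E (p * q) = k%:R * E (p * q).
  rewrite e2 mulrC [p * q]mulrC mulrC e1; apply: eq_bigr => b _.
  by rewrite mulrC.
move/eqP; rewrite -subr_eq0 -mulrBl mulf_eq0 subr_eq0 eqr_nat (negbTE jk) /=.
by move/eqP.
Qed.

Lemma chaos_mean0 j p : chaos j.+1 p -> E p = 0.
Proof.
move=> h; rewrite -[p]mulr1; apply: (@chaos_orthogonal _ 0 _ _ h) => //.
by rewrite -mpolyC1; exact: chaosC.
Qed.

Definition sqnorm (I : finType) (F : I -> poly) : poly := \sum_i F i ^+ 2.

(** Indexing by pairs makes the gradient of a family a family again, so that it can be iterated. *)
Definition gradient (I : finType) (F : I -> poly) : I * 'I_m -> poly :=
  fun ib => nabla ib.2 (F ib.1).

Lemma meval_sqnorm (I : finType) (F : I -> poly) v :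
  meval v (sqnorm F) = \sum_i meval v (F i) ^+ 2.
Proof. by rewrite raddf_sum /=; apply: eq_bigr => i _; rewrite rmorphXn. Qed.

Lemma meval_sqnorm_ge0 (I : finType) (F : I -> poly) v : 0 <= meval v (sqnorm F).
Proof. by rewrite meval_sqnorm sumr_ge0// => i _; exact: sqr_ge0. Qed.

Lemma sqnorm_gradient (I : finType) (F : I -> poly) :
  sqnorm (gradient F) = \sum_b \sum_i nabla b (F i) ^+ 2.
Proof. by rewrite exchange_big /= pair_big_dep. Qed.

Lemma nabla_sqnorm (I : finType) (F : I -> poly) b :
  nabla b (sqnorm F) = 2%:R *: \sum_i F i * nabla b (F i).
Proof.
rewrite raddf_sum scaler_sumr; apply: eq_bigr => i _.
by rewrite /= nablaXn expr1.
Qed.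

Lemma sqnorm_gradient_CauchySchwarz (I : finType) (F : I -> poly) v :
  meval v (\sum_b (\sum_i F i * nabla b (F i)) ^+ 2)
  <= meval v (sqnorm F * sqnorm (gradient F)).
Proof.
rewrite mevalM.
have -> : meval v (sqnorm (gradient F)) =
    \sum_b \sum_i meval v (nabla b (F i)) ^+ 2.
  rewrite sqnorm_gradient (raddf_sum (meval v)) /=; apply: eq_bigr => b _.
  by rewrite (raddf_sum (meval v)) /=; apply: eq_bigr => i _; rewrite rmorphXn.
rewrite (raddf_sum (meval v)) meval_sqnorm mulr_sumr.
apply: ler_sum => b _; rewrite /= rmorphXn /= (raddf_sum (meval v)) /=.
under eq_bigr do rewrite rmorphM.
exact: sum_CauchySchwarz.
Qed.

(** Apply [chaos_dirichlet] to each [(S ^+ k * F i) * F i]. The derivative falling on [F i] gives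
    one copy of [E (S ^+ k * G)]; the one falling on [S ^+ k] gives at most [2 k] further copies, by
    Cauchy-Schwarz. *)
Lemma sqnorm_pow_dirichlet (I : finType) (F : I -> poly) q k :
  (forall i, chaos q (F i)) ->
  q%:R * E (sqnorm F ^+ k.+1)
  <= (k.*2.+1)%:R * E (sqnorm F ^+ k * sqnorm (gradient F)).
Proof.
move=> hF; set S := sqnorm F; set G := sqnorm (gradient F).
have -> : q%:R * E (S ^+ k.+1) =
    E (S ^+ k * G) + \sum_b E (nabla b (S ^+ k) * \sum_i F i * nabla b (F i)).
  have -> : S ^+ k.+1 = \sum_i (S ^+ k * F i) * F i.
    rewrite exprSr {2}/S /sqnorm mulr_sumr; apply: eq_bigr => i _.
    by rewrite expr2 mulrA.
  rewrite Esum mulr_sumr; under eq_bigr do rewrite (chaos_dirichlet _ (hF _)).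
  rewrite exchange_big /= /G sqnorm_gradient mulr_sumr Esum -big_split /=.
  apply: eq_bigr => b _; rewrite mulr_sumr mulr_sumr !Esum -big_split /=.
  apply: eq_bigr => i _; rewrite -ED; congr E; rewrite nablaM; ring.
case: k => [|k].
  rewrite expr0 mul1r mul1r big1 ?addr0// => b _.
  by rewrite nabla1 mul0r E0.
have -> : \sum_b E (nabla b (S ^+ k.+1) * \sum_i F i * nabla b (F i)) =
    (k.+1.*2)%:R * E (S ^+ k * \sum_b (\sum_i F i * nabla b (F i)) ^+ 2).
  rewrite mulr_sumr Esum mulr_sumr; apply: eq_bigr => b _.
  rewrite nablaXn nabla_sqnorm -!scalerAr -!scalerAl EZ EZ -muln2 natrM.
  by rewrite expr2 !mulrA.
rewrite -[(k.+1.*2.+1)%:R]natr1 [leRHS]mulrDl mul1r [leRHS]addrC lerD2l.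
apply: ler_wpM2l => //; apply: E_mono => v.
rewrite exprSr -mulrA mevalM [leRHS]mevalM; apply: ler_wpM2l.
  by rewrite rmorphXn exprn_ge0// meval_sqnorm_ge0.
exact: sqnorm_gradient_CauchySchwarz.
Qed.

Lemma sqnorm_hypercontractive (I : finType) (F : I -> poly) q k :
  (forall i, chaos q (F i)) ->
  E (sqnorm F ^+ k.+1) <= (k.*2.+1)%:R ^+ (q * k.+1) * E (sqnorm F) ^+ k.+1.
Proof.
elim: q I F => [|q IH] I F hF.
  have [c ->] : exists c, sqnorm F = mpolyC n c.
    have /choice[c hc] := fun i => chaos0_const (hF i).
    exists (\sum_i c i ^+ 2); rewrite raddf_sum /=; apply: eq_bigr => i _.
    by rewrite hc !expr2 /= mpolyCM.
  by rewrite mul0n expr0 mul1r -rmorphXn /= !EC.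
set S := sqnorm F; set G := sqnorm (gradient F).
have S0 v : 0 <= meval v S := meval_sqnorm_ge0 F v.
have G0 v : 0 <= meval v G := meval_sqnorm_ge0 (gradient F) v.
have hG : forall ib, chaos q (gradient F ib) by move=> ib; exact: chaos_nabla.
have q0 : 0 < q.+1%:R :> R by [].
pose c : R := (k.*2.+1)%:R / q.+1%:R.
have c0 : 0 <= c by rewrite divr_ge0.
have h1 : E (S ^+ k.+1) <= c * E (S ^+ k * G).
  rewrite /c mulrAC ler_pdivlMr// mulrC; exact: sqnorm_pow_dirichlet.
(* Young's inequality with [a = S] and [b = c G]; its [k] copies of [E (S ^+ k.+1)] are then
   absorbed in the left-hand side of [h1]. *)
have young : k.+1%:R * (c * E (S ^+ k * G))
    <= k%:R * E (S ^+ k.+1) + c ^+ k.+1 * E (G ^+ k.+1).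
  rewrite -!EZ -ED; apply: E_mono => v.
  rewrite mevalD !mevalZ mevalM !rmorphXn /=.
  have := young_pow k (S0 v) (mulr_ge0 c0 (G0 v)).
  by rewrite exprMn [_ ^+ k * (c * _)]mulrCA.
have h2 : E (S ^+ k.+1) <= c ^+ k.+1 * E (G ^+ k.+1).
  have := ler_wpM2l (ler0n R k.+1) h1; rewrite -{1}natr1; lra.
have EG : E G = q.+1%:R * E S.
  have -> : E S = \sum_i E (F i ^+ 2) by exact: Esum.
  rewrite mulr_sumr.
  under eq_bigr do rewrite expr2 (chaos_dirichlet _ (hF _)).
  rewrite /G sqnorm_gradient exchange_big /= Esum; apply: eq_bigr => i _.
  by rewrite Esum; apply: eq_bigr => b _.
apply: (le_trans h2); have := IH _ _ hG; rewrite -/G EG => h3.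
apply: (le_trans (ler_wpM2l (exprn_ge0 _ c0) h3)).
(* The eigenvalue in [EG] cancels the denominator of [c], so each order costs exactly
   [(2k+1)^(k+1)]. *)
have cq : c ^+ k.+1 * q.+1%:R ^+ k.+1 = (k.*2.+1)%:R ^+ k.+1.
  by rewrite -exprMn /c divfK ?gt_eqF.
rewrite mulSn exprD [(_ * E S) ^+ _]exprMn -cq le_eqVlt; apply/orP; left; apply/eqP.
by move: (_ ^+ (q * k.+1)) (_ ^+ k.+1) (_ ^+ k.+1) (_ ^+ k.+1) => *; ring.
Qed.

Lemma chaos_hypercontractive p q k : chaos q p ->
  E (p ^+ k.+1.*2) <= (k.*2.+1)%:R ^+ (q * k.+1) * E (p ^+ 2) ^+ k.+1.
Proof.
move=> hp; have := @sqnorm_hypercontractive unit (fun=> p) q k (fun=> hp).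
by rewrite /sqnorm big_const card_unit /= addr0 -exprM mul2n.
Qed.

(** * The variance of the carre du champ and the gap of moments *)

Definition carre_du_champ (p : poly) : poly := \sum_b nabla b p ^+ 2.

Lemma moment_dirichlet q p k : chaos q p ->
  q%:R * E (p ^+ k.+2) = k.+1%:R * E (p ^+ k * carre_du_champ p).
Proof.
move=> hp; rewrite exprSr (chaos_dirichlet _ hp) mulr_sumr Esum mulr_sumr.
apply: eq_bigr => b _.
by rewrite nablaXn -scalerAl EZ expr2 mulrA.
Qed.

Section FourthMoment.
Variables (q : nat) (p : poly).
Hypotheses (hp : chaos q.+1 p) (p2 : E (p ^+ 2) = 1)
  (p_even : even_chaoses A q.+1.*2 (p ^+ 2)).

Local Notation G := (carre_du_champ p).

(* On [p ^+ 2 = \sum_r W r], with [W r] in chaos [2 (q + 1 - r)], the operator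
   [L + 2 (q + 1)] acts as multiplication by [2 r], and it sends [p ^+ 2] to
   twice the carre du champ. *)
Lemma carre_du_champ_decomp (W : nat -> poly) :
  p ^+ 2 = \sum_(r < q.+2) W r ->
  (forall r, (r <= q.+1)%N -> chaos (q.+1 - r).*2 (W r)) ->
  forall g, E (g * G) = \sum_(r < q.+2) r%:R * E (g * W r).
Proof.
move=> pW hW g.
have eW : E (g * p ^+ 2) = \sum_(r < q.+2) E (g * W r).
  by rewrite pW mulr_sumr Esum.
(* [e1] and [e2] share the cross term between the gradients of [g] and of [p ^+ 2], up to the same
   factor 1/2; subtracting them leaves the weight [(q+1) - (q+1-r) = r] on [W r]. *)
have e1 : q.+1%:R * E (g * p ^+ 2) =
    E (g * G) + \sum_b E (nabla b g * (p * nabla b p)).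
  rewrite expr2 mulrA (chaos_dirichlet _ hp) mulr_sumr Esum -big_split /=.
  by apply: eq_bigr => b _; rewrite -ED; congr E; rewrite nablaM; ring.
have e2 : \sum_(r < q.+2) (q.+1 - r)%:R * E (g * W r) =
    \sum_b E (nabla b g * (p * nabla b p)).
  apply: (@mulfI _ 2%:R); first by rewrite pnatr_eq0.
  rewrite !mulr_sumr.
  under eq_bigr => r _.
    rewrite mulrA -natrM mul2n (chaos_dirichlet _ (hW r _)); last by rewrite -ltnS.
    over.
  rewrite exchange_big /=; apply: eq_bigr => b _.
  rewrite -Esum -mulr_sumr -raddf_sum -pW /= nablaXn expr1 -scalerAr EZ.
  by [].
apply: (@addIr _ (\sum_b E (nabla b g * (p * nabla b p)))).
rewrite -e1 -e2 eW mulr_sumr -big_split /=; apply: eq_bigr => r _.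
by rewrite -mulrDl -natrD subnKC// -ltnS.
Qed.

(** The order of the chaos is [q.+1], so the ratio is the announced one. Both sides are computed
    exactly from the numbers [w r]. *)
Lemma variance_carre_du_champ :
  E ((q.+1%:R^-1 *: G - 1) ^+ 2)
  <= q%:R / (3 * q.+1%:R) * (E (p ^+ 4) - 3).
Proof.
have [W pW hW] := even_chaoses_decomp p_even.
have GW := carre_du_champ_decomp pW hW.
pose w r := E (W r ^+ 2).
have w0 r : 0 <= w r by apply: E_ge0 => v; rewrite rmorphXn sqr_ge0.
have orth (r s : 'I_q.+2) : r != s -> E (W s * W r) = 0.
  move=> rs; have hr := hW r (ltn_ord r); have hs := hW s (ltn_ord s).
  apply: (chaos_orthogonal hs hr); rewrite (inj_eq double_inj).
  by have := ltn_ord r; have := ltn_ord s; move: rs; rewrite -val_eqE /=; lia.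
have GWs (s : 'I_q.+2) : E (W s * G) = s%:R * w s.
  rewrite GW (bigD1 s)//= big1 ?addr0 ?expr2// => r rs.
  by rewrite orth ?mulr0.
(* The component of order 0 is the constant [E (p ^+ 2) = 1]. It is the mean removed from
   [G / (q+1)], and it accounts for the 3 subtracted from [E (p ^+ 4)]. *)
have w_top : w q.+1 = 1.
  have [c Wc] : exists c, W q.+1 = mpolyC n c.
    by apply/(@chaos0_const _ _ _ A); have := hW q.+1 (leqnn _); rewrite subnn.
  have : E (p ^+ 2) = c.
    rewrite pW Esum big_ord_recr /= big1 ?add0r; first by rewrite Wc EC.
    move=> r _; have := hW r (ltnW (ltn_ord r)).
    have -> : ((q.+1 - r).*2 = (q.+1 - r).*2.-1.+1)%N by have := ltn_ord r; lia.
    exact: chaos_mean0.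
  by rewrite p2 /w Wc => <-; rewrite mpolyC1 expr1n.
have q0 : q.+1%:R != 0 :> R by rewrite pnatr_eq0.
have EG : E G = q.+1%:R.
  by have := moment_dirichlet 0 hp; rewrite p2 expr0 !mul1r mulr1.
have EGG : E (G ^+ 2) = \sum_(r < q.+1) r%:R ^+ 2 * w r + q.+1%:R ^+ 2.
  rewrite expr2 GW big_ord_recr /= [G * W q.+1]mulrC (GWs ord_max) w_top mulr1.
  rewrite -expr2; congr (_ + _); apply: eq_bigr => r _.
  by rewrite mulrC [G * _]mulrC (GWs (widen_ord (leqnSn _) r)) mulrC mulrA expr2.
have E4 : q.+1%:R * E (p ^+ 4) = 3 * (\sum_(r < q.+1) r%:R * w r + q.+1%:R).
  rewrite (moment_dirichlet 2 hp); congr (_ * _).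
  rewrite {1}pW mulr_suml Esum big_ord_recr /= (GWs ord_max) w_top mulr1.
  by congr (_ + _); apply: eq_bigr => r _; rewrite (GWs (widen_ord (leqnSn _) r)).
have -> : E (p ^+ 4) = 3 * (\sum_(r < q.+1) r%:R * w r + q.+1%:R) / q.+1%:R.
  by rewrite -E4 mulrC mulKf.
have -> : E ((q.+1%:R^-1 *: G - 1) ^+ 2) =
    (\sum_(r < q.+1) r%:R ^+ 2 * w r) / q.+1%:R ^+ 2.
  have -> : (q.+1%:R^-1 *: G - 1) ^+ 2 =
      (q.+1%:R^-1 ^+ 2) *: (G ^+ 2) + ((- 2) * q.+1%:R^-1) *: G + 1.
    rewrite -!mul_mpolyC !mpolyCM mpolyCN mpolyC_nat; ring.
  rewrite !ED !EZ E1 EG EGG; field.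
  by rewrite addrC natr1.
have -> : q%:R / (3 * q.+1%:R) * (3 * (\sum_(r < q.+1) r%:R * w r + q.+1%:R) / q.+1%:R - 3)
   = (q%:R * \sum_(r < q.+1) r%:R * w r) / q.+1%:R ^+ 2.
  by field; rewrite addrC natr1.
rewrite ler_pM2r ?invr_gt0 ?exprn_gt0 ?ltr0n// mulr_sumr.
(* The only loss: [r ^+ 2 <= q * r] for [r <= q]. *)
apply: ler_sum => r _; rewrite mulrA ler_wpM2r// expr2 ler_wpM2r//.
by rewrite ler_nat -ltnS.
Qed.

Let s := Num.sqrt (q%:R / (3 * q.+1%:R) * (E (p ^+ 4) - 3)).

Lemma moment_recursion_le k :
  `|E (p ^+ k.+2) - k.+1%:R * E (p ^+ k)| <= k.+1%:R * (Num.sqrt (E (p ^+ k.*2)) * s).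
Proof.
have q0 : q.+1%:R != 0 :> R by rewrite pnatr_eq0.
have -> : E (p ^+ k.+2) - k.+1%:R * E (p ^+ k) =
    k.+1%:R * E (p ^+ k * (q.+1%:R^-1 *: G - 1)).
  rewrite mulrBr mulr1 EB mulrBr -scalerAr EZ; congr (_ - _).
  by rewrite mulrCA -(moment_dirichlet _ hp) mulKf.
rewrite normrM normr_nat ler_wpM2l// -sqrtr_sqr -sqrtrM; last first.
  by apply: E_ge0 => v; rewrite rmorphXn /= -muln2 exprM sqr_ge0.
apply: ler_wsqrtr; apply: (le_trans (expectation_CauchySchwarz _ _)).
rewrite -exprM muln2; apply: ler_wpM2l; last exact: variance_carre_du_champ.
by apply: E_ge0 => v; rewrite rmorphXn /= -muln2 exprM sqr_ge0.
Qed.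

(** The square root of Nelson's bound on [E (p ^+ k.*2)], for [k >= 1] and [E (p ^+ 2) = 1]. *)
Let h k : R := Num.sqrt ((k.*2.-1)%:R ^+ (q.+1 * k)).

Let moment_recursion_hyp k : `|E (p ^+ k.+3) - k.+2%:R * E (p ^+ k.+1)|
  <= k.+2%:R * (h k.+1 * s).
Proof.
apply: (le_trans (moment_recursion_le _)); rewrite ler_wpM2l// ler_wpM2r ?sqrtr_ge0//.
apply: ler_wsqrtr.
by have := chaos_hypercontractive k hp; rewrite p2 expr1n mulr1.
Qed.

Let h_growth k : k.+2%:R * h k.+1 <= h k.+3.
Proof.
have -> : k.+2%:R = Num.sqrt (k.+2%:R ^+ 2) :> R by rewrite sqrtr_sqr normr_nat.
rewrite -sqrtrM ?sqr_ge0//; apply: ler_wsqrtr.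
rewrite -!natrX -natrM ler_nat.
(* Two of the [k + 3] blocks of the exponent already dominate [(k+2)^2]. *)
have -> : (q.+1 * k.+3 = q.+1 * 2 + q.+1 * k.+1)%N by lia.
rewrite expnD leq_mul//.
  apply: (@leq_trans (k.+3.*2.-1 ^ 2)); first by rewrite leq_exp2r//; lia.
  by apply: leq_pexp2l; lia.
by rewrite leq_exp2r//; lia.
Qed.

(** Induction by steps of two, from the orders 3 and 4, where [E p = 0] and [E (p ^+ 2) = 1] are
    known. By [h_growth] a step turns the factor [2 ^+ k] into [1 + 2 ^+ k], which is at most
    [2 ^+ k.+2]. *)
Lemma moment_gap k :
  `|E (p ^+ k.+3) - normal_moment R k.+3| <= k.+2%:R * (2 ^+ k * h k.+1 * s).
Proof.
have s0 : 0 <= s by exact: sqrtr_ge0.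
have h0 j : 0 <= h j by exact: sqrtr_ge0.
have Ep : E p = 0 := chaos_mean0 hp.
have pow2 j : 1 <= 2 ^+ j :> R by apply: exprn_ege1; rewrite ler1n.
elim/ltn_ind: k => -[_|[_|k IH]].
- have := moment_recursion_hyp 0.
  by rewrite expr1 Ep mulr0 subr0 /= mulr0 subr0 expr0 mul1r.
- have := moment_recursion_hyp 1; rewrite p2 /= !mulr1 => /le_trans; apply.
  rewrite ler_wpM2l// expr1 -mulrA ler_peMl ?mulr_ge0// ler1n.
  by [].
- have IHk := IH k (ltnW (ltnSn _)).
  have hyp := moment_recursion_hyp k.+2.
  have -> : E (p ^+ k.+2.+3) - normal_moment R k.+2.+3 =
      (E (p ^+ k.+2.+3) - k.+2.+2%:R * E (p ^+ k.+3)) +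
      k.+2.+2%:R * (E (p ^+ k.+3) - normal_moment R k.+3) by rewrite /=; ring.
  apply: (le_trans (ler_normD _ _)); rewrite normrM normr_nat.
  apply: (le_trans (lerD hyp (ler_wpM2l (ler0n _ _) IHk))).
  rewrite -mulrDr ler_wpM2l//.
  have g := h_growth k.
  have -> : k.+2%:R * (2 ^+ k * h k.+1 * s) = 2 ^+ k * (k.+2%:R * h k.+1) * s by ring.
  rewrite -mulrDl ler_wpM2r// !exprS.
  have := ler_wpM2l (le_trans ler01 (pow2 k)) g.
  have := ler_wpM2r (h0 k.+3) (pow2 k); have := h0 k.+3.
  rewrite mul1r; move: (h k.+3) (2 ^+ k) (k.+2%:R * h k.+1) => x y z; nra.
Qed.

End FourthMoment.

End GaussianExpectation.

(** * Gaussian moments *)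

Section Density.
Local Open Scope ereal_scope.
Context d (T : measurableType d) (R : realType).
Variables (mu nu : {measure set T -> \bar R}) (g : T -> R).
Hypotheses (mg : measurable_fun [set: T] g) (g0 : forall x, (0 <= g x)%R).
Hypothesis nuE : forall A, measurable A -> nu A = \int[mu]_(x in A) (g x)%:E.

Import HBNNSimple.

Let integral_density_indic (A : set T) : measurable A ->
  \int[nu]_x (\1_A x)%:E = \int[mu]_x ((\1_A x)%:E * (g x)%:E).
Proof.
move=> mA; rewrite integral_indic// setIT nuE// [LHS]integral_mkcond/=.
apply: eq_integral => x _; rewrite patchE indicE; case: ifPn => _.
  by rewrite mul1e.
by rewrite mul0e.
Qed.

Let integral_density_nnsfun (h : {nnsfun T >-> R}) :
  \int[nu]_x (h x)%:E = \int[mu]_x ((h x)%:E * (g x)%:E).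
Proof.
have hE x : (h x)%:E = \sum_(r \in range h) (r * \1_(h @^-1` [set r]) x)%:E.
  by rewrite fimfunE -fsumEFin.
have mindic r : measurable_fun [set: T] (fun x => (\1_(h @^-1` [set r]) x : R)%:E).
  by apply/measurable_EFinP; exact: measurable_indic.
have mgE : measurable_fun [set: T] (fun x => (g x)%:E) by exact/measurable_EFinP.
under eq_integral do rewrite hE.
under [RHS]eq_integral => x _.
  rewrite hE ge0_mule_fsuml; last by move=> r; rewrite EFinM nnfun_muleindic_ge0.
  over.
rewrite !ge0_integral_fsum//=; last 4 first.
- move=> r; apply: emeasurable_funM => //.
  by apply/measurable_EFinP; exact: measurable_funM.
- move=> r x _; apply: mule_ge0; last by rewrite lee_fin.
  by rewrite EFinM nnfun_muleindic_ge0.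
- by move=> r; apply/measurable_EFinP; exact: measurable_funM.
- by move=> r x _; rewrite EFinM nnfun_muleindic_ge0.
apply: eq_fsbigr => r; rewrite inE => -[x _ <-].
under eq_integral do rewrite EFinM.
under [RHS]eq_integral do rewrite EFinM -muleA.
rewrite !ge0_integralZl//= ?lee_fin//.
- by rewrite integral_density_indic.
- exact: emeasurable_funM.
- by move=> y _; rewrite mule_ge0 ?lee_fin.
Qed.

(** Meant for [normal_prob], whose values are integrals of its density; the route is indicators,
    simple functions, monotone limits. *)
Lemma ge0_integral_density (f : T -> \bar R) :
  measurable_fun [set: T] f -> (forall x, 0 <= f x) ->
  \int[nu]_x f x = \int[mu]_x (f x * (g x)%:E).
Proof.
move=> mf f0; pose h := nnsfun_approx measurableT mf.
have hf x : (h n x)%:E @[n --> \oo] --> f x by exact: cvg_nnsfun_approx.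
have hnd x (i j : nat) : (i <= j)%N -> (h i x)%:E <= (h j x)%:E.
  by move=> ij; rewrite lee_fin; exact/lefP/nd_nnsfun_approx.
have mgE : measurable_fun [set: T] (fun x => (g x)%:E) by exact/measurable_EFinP.
have -> : \int[nu]_x f x = \int[nu]_x lim ((h n x)%:E @[n --> \oo]).
  by apply: eq_integral => x _; apply/esym/cvg_lim.
have -> : \int[mu]_x (f x * (g x)%:E) =
    \int[mu]_x lim ((h n x)%:E * (g x)%:E @[n --> \oo]).
  apply: eq_integral => x _; apply/esym/cvg_lim => //.
  by apply: cvgeZr => //; exact: hf.
rewrite !monotone_convergence//=.
- by congr (limn _); apply/funext => n; exact: integral_density_nnsfun.
- by move=> n; apply: emeasurable_funM => //; exact/measurable_EFinP.
- by move=> n x _; rewrite mule_ge0 ?lee_fin.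
- by move=> x _ i j ij; rewrite lee_wpmul2r ?lee_fin//; exact: hnd.
- by move=> n; exact/measurable_EFinP.
- by move=> n x _; rewrite lee_fin.
- by move=> x _ i j ij; exact: hnd.
Qed.

End Density.

(** Completing the square: weighting the density by [expR (t * x)] moves its mean to [s ^+ 2 * t]
    and releases the constant on the right. *)
Lemma integral_normal_expR (R : realType) (s t : R) : s != 0 ->
  (\int[normal_prob 0 s]_x (expR (t * x))%:E = (expR (s ^+ 2 * t ^+ 2 / 2))%:E)%E.
Proof.
move=> s0.
have mexp : measurable_fun [set: R] (fun x : R => (expR (t * x))%:E).
  apply/measurable_EFinP; apply: (measurableT_comp (@measurable_expR R)).
  exact: measurable_funM.
rewrite (@ge0_integral_density _ _ _ lebesgue_measure (normal_prob 0 s) _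
  (measurable_normal_pdf 0 s) (normal_pdf_ge0 0 s) (fun A _ => erefl)
  _ mexp (fun x => expR_ge0 (t * x))).
transitivity (\int[lebesgue_measure]_x
   ((expR (s ^+ 2 * t ^+ 2 / 2))%:E * (normal_pdf (s ^+ 2 * t) s x)%:E))%E.
  apply: eq_integral => x _; rewrite -!EFinM; congr EFin.
  rewrite !normal_pdfE// mulrCA [RHS]mulrCA; congr (_ * _).
  rewrite /normal_fun -!expRD; congr expR; field.
  by [].
rewrite ge0_integralZl//=.
- by rewrite integral_normal_pdf mule1.
- by apply/measurable_EFinP; exact: measurable_normal_pdf.
- by move=> x _; rewrite lee_fin normal_pdf_ge0.
Qed.

Section LawMgf.
Context d (Omega : measurableType d) (R : realType) (P : probability Omega R).

(* Covers the degenerate case [s = 0] as well. *)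
Definition gaussian_mgf (Y : Omega -> R) (s : R) := forall t : R,
  (\int[P]_w (expR (t * Y w))%:E = (expR (s ^+ 2 * t ^+ 2 / 2))%:E)%E.

Let integral_law (Y : {RV P >-> R})
    (mu : {measure set (measurableTypeR R) -> \bar R}) t : has_law Y mu ->
  (\int[P]_w (expR (t * Y w))%:E = \int[mu]_x (expR (t * x))%:E)%E.
Proof.
move=> Ylaw; pose phi : Omega -> measurableTypeR R := Y.
have mphi : measurable_fun [set: Omega] phi by exact: (@measurable_funPT _ _ _ _ Y).
pose Y' : {mfun Omega >-> measurableTypeR R} :=
  HB.pack phi (isMeasurableFun.Build _ _ _ _ _ mphi).
rewrite (@eq_measure_integral _ _ _ _ (distribution P Y') mu); last first.
  by move=> A mA _; apply: esym; exact: Ylaw.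
rewrite ge0_integral_distribution//.
apply/measurable_EFinP; apply: (measurableT_comp (@measurable_expR R)).
exact: measurable_funM.
Qed.

Lemma normal_gaussian_mgf (Y : {RV P >-> R}) s :
  s != 0 -> has_law Y (normal_prob 0 s) -> gaussian_mgf Y s.
Proof.
move=> s0 Ylaw t; rewrite (@integral_law _ (normal_prob 0 s) t Ylaw).
exact: integral_normal_expR.
Qed.

Lemma centered_normal_gaussian_mgf (Y : {RV P >-> R}) s :
  has_law Y (centered_normal s) -> gaussian_mgf Y s.
Proof.
rewrite /centered_normal; case: eqVneq => [->|s0]; last exact: normal_gaussian_mgf.
move=> Ylaw t; rewrite (@integral_law _ (@dirac _ (measurableTypeR R) 0 R) t Ylaw).
rewrite integral_dirac//=.
  by rewrite diracT mul1e mulr0 expr0n /= !mul0r.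
apply/measurable_EFinP; apply: (measurableT_comp (@measurable_expR R)).
exact: measurable_funM.
Qed.

End LawMgf.

Lemma pow_le_expR (R : realType) (k : nat) (y : R) : 0 <= y ->
  y ^+ k <= k`!%:R * expR y.
Proof.
move=> y0; case: k => [|k].
  by rewrite expr0 mul1r -[leLHS]addr0 (le_trans _ (expR_ge1Dx y))// lerD2l.
rewrite mulrC -ler_pdivrMr ?ltr0n ?fact_gt0//.
by apply: le_trans (expR_ge1Dxn k y0); rewrite lerDr.
Qed.

Lemma expR_le_cosh (R : realType) (t c x : R) : `|t| <= c ->
  expR (t * x) <= expR (c * x) + expR (- c * x).
Proof.
move=> tc; have /orP[x0|x0] := le_total 0 x.
  apply: (@le_trans _ _ (expR (c * x))); last by rewrite lerDl expR_ge0.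
  by rewrite ler_expR ler_wpM2r// (le_trans (ler_norm _)).
apply: (@le_trans _ _ (expR (- c * x))); last by rewrite lerDr expR_ge0.
by rewrite ler_expR ler_wnM2r// lerNl (le_trans _ tc)// -normrN ler_norm.
Qed.

(** * Real expectations, and moments from the moment generating function *)

Section RealExpectation.
Context d (Omega : measurableType d) (R : realType) (P : probability Omega R).
Implicit Types f g : Omega -> R.

Definition integrableR f := P.-integrable [set: Omega] (EFin \o f).

Definition Ex f : R := \int[P]_w f w.

Lemma integrableRD f g : integrableR f -> integrableR g ->
  integrableR (fun w => f w + g w).
Proof.
by move=> hf hg; exact: (eq_integrable _ _ _ _ (integrableD measurableT hf hg)).
Qed.

Lemma integrableRZ c f : integrableR f -> integrableR (fun w => c * f w).
Proof.
by move=> hf; exact: (eq_integrable _ _ _ _ (integrableZl measurableT c hf)).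
Qed.

Lemma integrableR_cst c : integrableR (fun=> c).
Proof. exact: finite_measure_integrable_cst. Qed.

Lemma integrableR_le f g : measurable_fun [set: Omega] f ->
  (forall w, `|f w| <= g w) -> integrableR g -> integrableR f.
Proof.
move=> mf fg; apply: le_integrable => //; first exact/measurable_EFinP.
by move=> w _ /=; rewrite lee_fin (le_trans (fg w))// ler_norm.
Qed.

Lemma ExD f g : integrableR f -> integrableR g ->
  Ex (fun w => f w + g w) = Ex f + Ex g.
Proof. by move=> hf hg; rewrite /Ex RintegralD. Qed.

Lemma ExZ c f : integrableR f -> Ex (fun w => c * f w) = c * Ex f.
Proof. by move=> hf; rewrite /Ex RintegralZl. Qed.

Lemma Ex_cst c : Ex (fun=> c) = c.
Proof.
rewrite /Ex /Rintegral integral_cst//=.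
by rewrite (_ : P _ = 1%E) ?mule1//; exact: probability_setT.
Qed.

Lemma Ex_le f g : integrableR f -> integrableR g ->
  (forall w, f w <= g w) -> Ex f <= Ex g.
Proof. by move=> hf hg fg; apply: le_Rintegral => // w _. Qed.

Lemma Ex_ge0 f : (forall w, 0 <= f w) -> 0 <= Ex f.
Proof. by move=> f0; apply: Rintegral_ge0 => w _. Qed.

Lemma eq_Ex f g : f =1 g -> Ex f = Ex g.
Proof. by move=> /funext ->. Qed.

Lemma expectationE f : integrableR f -> ('E_P[f] = (Ex f)%:E)%E.
Proof.
move=> hf; rewrite unlock /Ex /Rintegral fineK//.
exact: (integrable_fin_num measurableT hf).
Qed.

Lemma integrableR_ge0 f c : measurable_fun [set: Omega] f -> (forall w, 0 <= f w) ->
  (\int[P]_w (f w)%:E <= c%:E)%E -> integrableR f.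
Proof.
move=> mf f0 h; apply/integrableP; split; first exact/measurable_EFinP.
under eq_integral do rewrite gee0_abs ?lee_fin//.
exact: (le_lt_trans h (ltry _)).
Qed.

Section GaussianMgf.
Variables (Y : Omega -> R) (s : R).
Hypotheses (mY : measurable_fun [set: Omega] Y) (Ymgf : gaussian_mgf P Y s).

Let mexp (t : R) : measurable_fun [set: Omega] (fun w => expR (t * Y w)).
Proof.
apply: (measurableT_comp (@measurable_expR R)).
exact: measurable_funM.
Qed.

Let int_exp t : integrableR (fun w => expR (t * Y w)).
Proof.
apply: (@integrableR_ge0 _ (expR (s ^+ 2 * t ^+ 2 / 2))) => //.
by rewrite (Ymgf t).
Qed.

(** The rate [c + 1] instead of [c] pays for [|Y| ^+ k <= k! * expR |Y|]. *)
Let dominating (k : nat) (c : R) w :=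
  k`!%:R * (expR ((c + 1) * Y w) + expR (- (c + 1) * Y w)).

Let int_dominating k c : integrableR (dominating k c).
Proof. by apply: integrableRZ; apply: integrableRD; exact: int_exp. Qed.

Let dominatingP (k : nat) (c t : R) w : `|t| <= c ->
  `|Y w ^+ k * expR (t * Y w)| <= dominating k c w.
Proof.
move=> tc; rewrite normrM normrX (ger0_norm (expR_ge0 _)) /dominating.
apply: (@le_trans _ _ (k`!%:R * expR `|Y w| * expR (t * Y w))).
  by rewrite ler_wpM2r ?expR_ge0// pow_le_expR.
rewrite -mulrA -expRD ler_wpM2l//.
have [Y0|Y0] := ger0P (Y w).
  rewrite -[X in X + _]mul1r -mulrDl; apply: expR_le_cosh.
  by rewrite (le_trans (ler_normD _ _))// normr1 addrC lerD2r.
rewrite -[X in X + _]mulN1r -mulrDl; apply: expR_le_cosh.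
by rewrite (le_trans (ler_normD _ _))// normrN1 addrC lerD2r.
Qed.

Let mmom k t : measurable_fun [set: Omega] (fun w => Y w ^+ k * expR (t * Y w)).
Proof.
by apply: measurable_funM; [exact: measurable_funX|exact: mexp].
Qed.

Let int_mom k t : integrableR (fun w => Y w ^+ k * expR (t * Y w)).
Proof.
apply: (integrableR_le (mmom k t)); last exact: (int_dominating k `|t|).
by move=> w; exact: dominatingP.
Qed.

Let phi (k : nat) (t : R) := Ex (fun w => Y w ^+ k * expR (t * Y w)).

Let derive_mom (k : nat) (t : R) w :
  is_derive t (1 : R) (fun u : R => Y w ^+ k * expR (u * Y w)) (Y w ^+ k.+1 * expR (t * Y w)).
Proof.
apply: is_derive_eq.
by rewrite /GRing.scale /= exprS; ring.
Qed.

Let is_derive_phi k (t : R) : is_derive t (1 : R) (phi k) (phi k.+1 t).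
Proof.
pose f (u : R) w := Y w ^+ k * expR (u * Y w).
(* On this window every parameter is at most [|t| + 1] in absolute value, so one function dominates
   all the derivatives. *)
have It : `]t - 1, t + 1[%classic t by rewrite /= in_itv /= ltrBlDr ltrDl ltr01.
have d1 u w : partial1of2 f u w = Y w ^+ k.+1 * expR (u * Y w).
  by rewrite partial1of2E; have h := derive_mom k u w; rewrite derive_val.
pose G := dominating k.+1 (`|t| + 1).
have G0 w : 0 <= G w.
  by rewrite mulr_ge0// addr_ge0 ?expR_ge0.
have Gub u w : `]t - 1, t + 1[%classic u -> [set: Omega] w ->
    `|partial1of2 f u w| <= G w.
  rewrite /= in_itv /= => /andP[u1 u2] _; rewrite d1; apply: dominatingP.
  rewrite -[u](subrK t) addrC (le_trans (ler_normD _ _))// lerD2l ler_norml.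
  by apply/andP; split; lra.
have intf u : `]t - 1, t + 1[%classic u -> P.-integrable [set: Omega] (EFin \o f u).
  by move=> _; exact: int_mom.
have derf u w : `]t - 1, t + 1[%classic u -> [set: Omega] w -> derivable (f ^~ w) u 1.
  by move=> _ _; have h := derive_mom k u w; exact: ex_derive.
have intG : P.-integrable [set: Omega] (EFin \o G) by exact: int_dominating.
have H1 := derivable_under_integral measurableT It intf derf G0 intG Gub.
have H2 := differentiation_under_integral measurableT It intf derf G0 intG Gub.
apply: DeriveDef => //; rewrite -derive1E H2; apply: eq_Rintegral => w _.
exact: d1.
Qed.

Let phi0 t : phi 0%N t = expR (s ^+ 2 * t ^+ 2 / 2).
Proof.
by rewrite /phi /Ex /Rintegral; under eq_integral do rewrite expr0 mul1r; rewrite (Ymgf t).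
Qed.

(** The generating function solves [phi' = s^2 t phi]; this is its [k]-th derivative. At [k = 0] the
    index [k.-1] is harmless, its coefficient being 0. *)
Let phi_rec k t : phi k.+1 t = s ^+ 2 * (t * phi k t + k%:R * phi k.-1 t).
Proof.
have phiS j u : phi j.+1 u = 'D_1 (phi j) u.
  by have h := is_derive_phi j u; rewrite derive_val.
elim: k t => [|k IH] t; rewrite phiS.
  have h : is_derive t (1 : R) (fun t : R => expR (s ^+ 2 * t ^+ 2 / 2))
      (s ^+ 2 * (t * expR (s ^+ 2 * t ^+ 2 / 2))).
    by apply: is_derive_eq; rewrite /GRing.scale /=; field.
  rewrite mul0r addr0 phi0 (_ : phi _ = fun t => expR (s ^+ 2 * t ^+ 2 / 2)).
    by rewrite derive_val.
  by apply/funext => u; exact: phi0.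
rewrite (_ : phi k.+1 = fun t => s ^+ 2 * (t * phi k t + k%:R * phi k.-1 t)); last first.
  by apply/funext => u; exact: IH.
have h1 := is_derive_phi k t; have h2 := is_derive_phi k.-1 t.
rewrite derive_val /GRing.scale /=.
rewrite (IH t); case: k h2 {IH h1} => [|k] _ /=; rewrite -?natr1; ring.
Qed.

Lemma gaussian_mgf_integrable k : integrableR (fun w => `|Y w| ^+ k).
Proof.
apply: (@integrableR_le _ (dominating k 0)); last exact: int_dominating.
  by apply: measurable_funX; exact: measurableT_comp.
move=> w; rewrite normrX normr_id -normrX.
have : `|(0 : R)| <= 0 by rewrite normr0.
by move=> /(@dominatingP k 0 0 w); rewrite mul0r expR0 mulr1.
Qed.

Lemma gaussian_mgf_mean : Ex Y = 0.
Proof.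
have := phi_rec 0%N 0; rewrite !mul0r addr0 mulr0 => <-.
by apply: eq_Ex => w; rewrite expr1 mul0r expR0 mulr1.
Qed.

Lemma gaussian_mgf_moment k :
  Ex (fun w => Y w ^+ k.+2) = k.+1%:R * s ^+ 2 * Ex (fun w => Y w ^+ k).
Proof.
have phiE j : phi j 0 = Ex (fun w => Y w ^+ j).
  by apply: eq_Ex => w; rewrite mul0r expR0 mulr1.
by rewrite -!phiE phi_rec mul0r add0r mulrCA mulrA.
Qed.

End GaussianMgf.
End RealExpectation.

(** * Gaussian integration by parts *)

Lemma horner_ext (R : numDomainType) (p q : {poly R}) :
  (forall t, p.[t] = q.[t]) -> p = q.
Proof.
move=> pq; apply/eqP; rewrite -subr_eq0; apply: contraT => pq0.
pose rs : seq R := [seq i%:R | i <- iota 0 (size (p - q))].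
have urs : uniq rs.
  by rewrite map_inj_uniq ?iota_uniq// => i j /eqP; rewrite eqr_nat => /eqP.
have ars : all (root (p - q)) rs.
  by apply/allP => x _; rewrite rootE hornerD hornerN pq subrr.
by have := max_poly_roots pq0 ars urs; rewrite size_map size_iota ltnn.
Qed.

Section IntegrationByParts.
Variables (R : realType) (n m : nat) (A : 'I_m -> 'I_n -> R).
Local Notation poly := (mpoly n R).
Local Notation "''X_' i" := (mpolyX R (mnm1 i) : poly).
Local Notation delta := (delta A).

Definition linear_form (a : 'I_n -> R) : poly := \sum_i a i *: 'X_i.

(** The variance of the linear form with coefficients [a]. *)
Definition gram_quad (a : 'I_n -> R) : R := \sum_b (\sum_i A b i * a i) ^+ 2.

Let bump (a : 'I_n -> R) (t : R) (i j : 'I_n) : R := a j + t * (j == i)%:R.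

Let linear_form_bump a t i :
  linear_form (bump a t i) = linear_form a + t *: 'X_i.
Proof.
rewrite /linear_form [in RHS](_ : 'X_i = \sum_j (j == i)%:R *: 'X_j).
  rewrite scaler_sumr -big_split /=; apply: eq_bigr => j _.
  by rewrite /bump scalerDl scalerA.
rewrite (bigD1 i)//= eqxx scale1r big1 ?addr0// => j /negbTE ->.
by rewrite scale0r.
Qed.

Section LinearFunctional.
Variable T : poly -> R.
Hypothesis T_lin : forall c p q, T (c *: p + q) = c * T p + T q.

Let TD p q : T (p + q) = T p + T q.
Proof. by rewrite -[p in LHS]scale1r T_lin mul1r. Qed.

Let T0 : T 0 = 0.
Proof. by apply: (@addrI _ (T 0)); rewrite -TD !addr0. Qed.

Let TZ c p : T (c *: p) = c * T p.
Proof. by rewrite -[c *: p]addr0 T_lin T0 addr0. Qed.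

Let Tsum (I : Type) (r : seq I) (F : I -> poly) :
  T (\sum_(i <- r) F i) = \sum_(i <- r) T (F i).
Proof. exact: (big_morph _ TD T0). Qed.

(** [T ((u + t v)^k f)] expanded in [t], so that polarization amounts to reading a coefficient. *)
Definition pencil (u v f : poly) (k : nat) : {poly R} :=
  \poly_(j < k.+1) (T (u ^+ (k - j) * v ^+ j * f) *+ 'C(k, j)).

Lemma horner_pencil u v f k t :
  (pencil u v f k).[t] = T ((u + t *: v) ^+ k * f).
Proof.
rewrite horner_poly exprDn mulr_suml Tsum; apply: eq_bigr => j _.
rewrite exprZn -scalerAr -[(_ *: _) *+ _]scaler_nat -!scalerAl !TZ.
by rewrite -[in LHS]mulr_natl; ring.
Qed.

(* Polarization: the coefficient of [t] in [(u + t v)^(k+1)]. *)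
Lemma pencil_coef1 u v f k :
  (pencil u v f k.+1)`_1 = k.+1%:R * T (u ^+ k * (v * f)).
Proof. by rewrite coef_poly /= subn1 bin1 expr1 -mulrA mulr_natl. Qed.

Lemma pencil_coef0 u v f k : (pencil u v f k)`_0 = T (u ^+ k * f).
Proof. by rewrite coef_poly /= subn0 bin0 mulr1n expr0 mulr1. Qed.

(** The property [Q] is stable under multiplication by a variable: move [a] along the [i]-th
    coordinate and read the coefficient of [t]. Hence it holds for monomials, and its case [k = 0]
    is the claim. *)
Lemma linear_forms_span :
  (forall a k, T (linear_form a ^+ k) = 0) -> forall p, T p = 0.
Proof.
move=> T_form.
pose Q f := forall a k, T (linear_form a ^+ k * f) = 0.
have Q1 : Q 1 by move=> a k; rewrite mulr1.
have QX i f : Q f -> Q ('X_i * f).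
  move=> hf a k; have p0 : pencil (linear_form a) 'X_i f k.+1 = 0.
    apply: horner_ext => t; rewrite horner_pencil horner0.
    by rewrite -linear_form_bump hf.
  have := pencil_coef1 (linear_form a) 'X_i f k.
  by rewrite p0 coef0 => /esym/eqP; rewrite mulf_eq0 pnatr_eq0 /= => /eqP.
have Qm (mon : multinom n) : Q (mpolyX R mon).
  pose Q' g := forall f, Q f -> Q (g * f).
  suff : Q' (mpolyX R mon) by move/(_ _ Q1); rewrite mulr1.
  rewrite mpolyXE_id; apply: (big_ind Q').
  - by move=> f; rewrite mul1r.
  - by move=> g h hg hh f hf; rewrite -mulrA; apply/hg/hh.
  - move=> i _; elim: (mon i) => [|k IH] f hf; first by rewrite expr0 mul1r.
    by rewrite exprS -mulrA; apply/QX/IH.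
elim/mpolyind => [//|c mon p _ _ IH].
by rewrite TD TZ IH addr0; have := Qm mon (fun=> 0) 0%N; rewrite expr0 mul1r => ->; rewrite mulr0.
Qed.
End LinearFunctional.

Variable E : poly -> R.
Hypothesis E_lin : forall c p q, E (c *: p + q) = c * E p + E q.
Hypothesis E_form1 : forall a, E (linear_form a) = 0.
Hypothesis E_form : forall a k, E (linear_form a ^+ k.+2) =
  k.+1%:R * gram_quad a * E (linear_form a ^+ k).

(** The covariance of ['X_i] with the linear form of coefficients [a]. *)
Let gram_lin a i : R := \sum_b A b i * \sum_j A b j * a j.

Let gram_quad_bump a t i : gram_quad (bump a t i) =
  gram_quad a + 2 * gram_lin a i * t + (\sum_b A b i ^+ 2) * t ^+ 2.
Proof.
rewrite /gram_quad /gram_lin mulr_sumr !mulr_suml -!big_split /=.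
apply: eq_bigr => b _.
have -> : \sum_j A b j * bump a t i j = \sum_j A b j * a j + t * A b i.
  rewrite /bump; under eq_bigr do rewrite mulrDr.
  rewrite big_split /=; congr (_ + _).
  rewrite (bigD1 i)//= eqxx mulr1 big1 ?addr0 1?mulrC// => j /negbTE ->.
  by rewrite !mulr0.
ring.
Qed.

(** The moment recursion holds for all forms [bump a t i], hence as an identity between polynomials
    in [t]. Its coefficient of [t] expresses the moment at [k] by the one at [k - 2] and by
    [E (linear_form a ^+ k.-1)]. *)
Let E_form_var a i k :
  E ('X_i * linear_form a ^+ k) = k%:R * gram_lin a i * E (linear_form a ^+ k.-1).
Proof.
have EX0 : E 'X_i = 0.
  have := E_form1 (bump (fun=> 0) 1 i); rewrite linear_form_bump scale1r.
  by rewrite /linear_form big1 ?add0r// => j _; rewrite scale0r.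
have quad_eq j : pencil E (linear_form a) 'X_i 1 j.+2 =
    j.+1%:R%:P * ((gram_quad a)%:P + (2 * gram_lin a i) *: 'X
      + (\sum_b A b i ^+ 2) *: 'X^2) * pencil E (linear_form a) 'X_i 1 j.
  apply: horner_ext => t.
  rewrite !(hornerM, hornerD, hornerZ, hornerC, hornerX, hornerXn).
  rewrite !horner_pencil// !mulr1.
  by rewrite -linear_form_bump E_form gram_quad_bump.
have coef1 j : j.+2%:R * E ('X_i * linear_form a ^+ j.+1) =
    j.+1%:R * (gram_quad a * (pencil E (linear_form a) 'X_i 1 j)`_1
      + 2 * gram_lin a i * E (linear_form a ^+ j)).
  have := pencil_coef1 E (linear_form a) 'X_i 1 j.+1.
  rewrite quad_eq mulr1 [_ * 'X_i]mulrC => <-.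
  rewrite -mulrA coefCM; congr (_ * _).
  rewrite !mulrDl !coefD coefCM -!scalerAl !coefZ coefXM coefXnM /= mulr0 addr0.
  by rewrite pencil_coef0 mulr1 /GRing.scale /=; ring.
elim/ltn_ind: k => -[_|k IH]; first by rewrite expr0 mulr1 EX0 !mul0r.
have k0 : k.+2%:R != 0 :> R by rewrite pnatr_eq0.
apply: (mulfI k0); rewrite coef1 /=.
case: k IH {k0} => [|k] IH.
  by rewrite /pencil coef_poly /= mulr0 add0r; ring.
rewrite pencil_coef1 mulr1 [_ * 'X_i]mulrC (IH k)//=.
case: k {IH} => [|k].
  by rewrite /= expr0 expr1 E_form1 !(mulr0, mul0r, add0r); ring.
by rewrite E_form /= -!natr1; ring.
Qed.

(** The difference of both sides is linear in [p], so powers of linear forms suffice; there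
    [E_form_var] is the formula. *)
Lemma gaussian_ibp i p : E ('X_i * p) = E (delta i p).
Proof.
pose T p := E ('X_i * p) - E (delta i p).
apply/eqP; rewrite -subr_eq0; apply/eqP; rewrite -/(T p).
have ED p' q' : E (p' + q') = E p' + E q'.
  by rewrite -[p' in LHS]scale1r E_lin mul1r.
apply: (linear_forms_span (T := T)).
  move=> c p' q'; rewrite /T linearP /= mulrDr -scalerAr !E_lin; ring.
move=> a k; rewrite /T E_form_var.
have nablaL b : nabla A b (linear_form a) = mpolyC n (\sum_j A b j * a j).
  rewrite /linear_form raddf_sum /= [in RHS]raddf_sum /=; apply: eq_bigr => j _.
  by rewrite linearZ /= nablaX -mul_mpolyC -mpolyCM mulrC.
have -> : delta i (linear_form a ^+ k) =
    (k%:R * gram_lin a i) *: (linear_form a ^+ k.-1).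
  rewrite /delta -mulr_algl /gram_lin.
  case: k => [|k] /=.
    by rewrite big1 ?mul0r ?scale0r ?mul0r// => b _; rewrite nabla1 scaler0.
  rewrite mulr_algl mulr_sumr scaler_suml; apply: eq_bigr => b _.
  rewrite nablaXn nablaL [_ * mpolyC _ _]mulrC mul_mpolyC !scalerA.
  by congr (_ *: _); ring.
have E0 : E 0 = 0 by apply: (@addrI _ (E 0)); rewrite -ED !addr0.
by rewrite -[_ *: _]addr0 E_lin E0 addr0 subrr.
Qed.

End IntegrationByParts.

(** Gram-Schmidt on possibly dependent vectors: each nonzero pivot contributes one row of [A]. *)
Lemma gram_factor (R : realType) (H : completeNormedModType R)
  (dot : {dot H for idfun}) (dot_norm : forall h : H, dot h h = `|h| ^+ 2)
  (n : nat) (h : 'I_n -> H) :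
  exists (m : nat) (A : 'I_m -> 'I_n -> R),
    forall i j, dot (h i) (h j) = \sum_b A b i * A b j.
Proof.
have dotC x y : dot x y = dot y x by rewrite hermC /= expr0 mul1r.
(* [k] bounds the indices of the vectors not yet eliminated; for [k = n] the condition is void. *)
suff: forall k (h : 'I_n -> H), (forall i : 'I_n, (k <= i)%N -> h i = 0) ->
    exists (m : nat) (A : 'I_m -> 'I_n -> R),
      forall i j, dot (h i) (h j) = \sum_b A b i * A b j.
  by move=> /(_ n h); apply => i; rewrite leqNgt ltn_ord.
elim=> [|k IH] {}h hk.
  exists 0%N, (fun _ _ => 0) => i j.
  by rewrite hk// linear0l big_ord0.
have [kn|nk] := ltnP k n; last first.
  by apply: IH => i ki; move: (leq_trans (ltn_ord i) nk); rewrite ltnNge ki.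
pose o := Ordinal kn.
have [ho|ho] := eqVneq (h o) 0.
  apply: IH => i; rewrite leq_eqVlt => /predU1P[ki|]; last exact: hk.
  by rewrite -ho; congr h; apply: val_inj.
pose N := `|h o|.
have N0 : N != 0 by rewrite normr_eq0.
pose c i := dot (h i) (h o) / N.
pose h' i := h i - (c i / N) *: h o.
have h'k (i : 'I_n) : (k <= i)%N -> h' i = 0.
  rewrite leq_eqVlt => /predU1P[ki|ki].
    have -> : i = o by apply: val_inj.
    by rewrite /h' /c dot_norm -/N expr2 mulfK// divff// scale1r subrr.
  by rewrite /h' /c hk// linear0l !mul0r scale0r subrr.
have [m [A hA]] := IH _ h'k.
exists m.+1, (fun b i => if unlift ord0 b is Some b' then A b' i else c i).
move=> i j; rewrite big_ord_recl unlift_none.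
under eq_bigr do rewrite liftK.
have dotZl a x y : dot (a *: x) y = a * dot x y by rewrite linearZl_LR.
have dotZr a x y : dot x (a *: y) = a * dot x y by rewrite linearZr_LR.
rewrite -hA /h' !linearBl !linearBr /= !dotZl !dotZr dot_norm -/N.
rewrite -[dot (h i) (h o)](divfK N0) -/(c i).
rewrite [dot (h o) (h j)]dotC -[dot (h j) (h o)](divfK N0) -/(c j).
by field.
Qed.

(** * Polynomials of an isonormal process *)

Section Moments.
Context d (Omega : measurableType d) (R : realType) (P : probability Omega R).
Implicit Types f g : Omega -> R.
Local Notation integrableR := (integrableR P).

(** An algebra of functions, so that integrability of polynomial expressions follows by closure
    properties. *)
Definition has_moments f := measurable_fun [set: Omega] f /\
  forall k, integrableR (fun w => `|f w| ^+ k).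

Lemma has_moments_cst c : has_moments (fun=> c).
Proof. by split => // k; exact: integrableR_cst. Qed.

Lemma has_momentsD f g : has_moments f -> has_moments g ->
  has_moments (fun w => f w + g w).
Proof.
move=> [mf hf] [mg hg]; have mfg : measurable_fun [set: Omega] (fun w => f w + g w).
  exact: measurable_funD.
split=> // k.
apply: (@integrableR_le _ _ _ _ _ (fun w => 2 ^+ k * (`|f w| ^+ k + `|g w| ^+ k))).
- by apply: measurable_funX; exact: measurableT_comp.
- move=> w; rewrite normrX normr_id.
  have le2 x y : 0 <= x -> x <= y -> (x + y) ^+ k <= 2 ^+ k * (x ^+ k + y ^+ k) :> R.
    move=> x0 xy; have y0 := le_trans x0 xy.
    apply: (@le_trans _ _ (2 ^+ k * y ^+ k)).
      by rewrite -exprMn; apply: lerXn2r; rewrite ?nnegrE ?addr_ge0//; lra.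
    by rewrite ler_wpM2l ?exprn_ge0// lerDr exprn_ge0.
  apply: (@le_trans _ _ ((`|f w| + `|g w|) ^+ k)).
    by apply: lerXn2r; rewrite ?nnegrE ?addr_ge0// ler_normD.
  have /orP[fg|gf] := le_total `|f w| `|g w|; first exact: le2.
  by rewrite addrC [X in _ * X]addrC; exact: le2.
- by apply: integrableRZ; apply: integrableRD.
Qed.

Lemma has_momentsM f g : has_moments f -> has_moments g ->
  has_moments (fun w => f w * g w).
Proof.
move=> [mf hf] [mg hg]; have mfg : measurable_fun [set: Omega] (fun w => f w * g w).
  exact: measurable_funM.
split=> // k.
apply: (@integrableR_le _ _ _ _ _ (fun w => `|f w| ^+ (k * 2) + `|g w| ^+ (k * 2))).
- by apply: measurable_funX; exact: measurableT_comp.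
- move=> w; rewrite normrX normr_id normrM exprMn !exprM.
  set x := `|f w| ^+ k; set y := `|g w| ^+ k.
  have := sqr_ge0 (x - y); have : 0 <= x * y by rewrite mulr_ge0 ?exprn_ge0.
  nra.
- by apply: integrableRD.
Qed.

Lemma has_momentsZ c f : has_moments f -> has_moments (fun w => c * f w).
Proof. by apply: has_momentsM; exact: has_moments_cst. Qed.

Lemma has_momentsX f k : has_moments f -> has_moments (fun w => f w ^+ k).
Proof.
move=> hf; elim: k => [|k IH]; first exact: has_moments_cst.
by under eq_fun do rewrite exprS; exact: has_momentsM.
Qed.

Lemma has_momentsN f : has_moments f -> has_moments (fun w => - f w).
Proof. by move=> hf; under eq_fun do rewrite -mulN1r; exact: has_momentsZ. Qed.

Lemma has_momentsB f g : has_moments f -> has_moments g ->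
  has_moments (fun w => f w - g w).
Proof. by move=> hf hg; apply: has_momentsD => //; exact: has_momentsN. Qed.

Lemma has_moments_norm f : has_moments f -> has_moments (fun w => `|f w|).
Proof.
move=> [mf hf]; split; first exact: measurableT_comp.
by move=> k; under eq_fun do rewrite normr_id; exact: hf.
Qed.

Lemma has_moments_integrable f : has_moments f -> integrableR f.
Proof.
move=> [mf hf]; apply: (integrableR_le mf) (hf 1%N) => w.
by rewrite expr1.
Qed.

Lemma has_moments_meval (n : nat) (Y : 'I_n -> Omega -> R) (p : mpoly n R) :
  (forall i, has_moments (Y i)) -> has_moments (fun w => meval (Y^~ w) p).
Proof.
move=> hY; elim/mpolyind: p => [|c mon p _ _ IH].
  by under eq_fun do rewrite meval0; exact: has_moments_cst.
under eq_fun do rewrite mevalD mevalZ mevalX.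
apply: has_momentsD => //; apply: has_momentsZ.
elim: (index_enum _) => [|i s IHs].
  by under eq_fun do rewrite big_nil; exact: has_moments_cst.
under eq_fun do rewrite big_cons.
by apply: has_momentsM => //; exact: has_momentsX.
Qed.

End Moments.

(** * Hermite polynomials: iterated derivatives and the three-term recursion *)

Fixpoint hermite_rec (R : realType) (k : nat) (x : R) : R :=
  match k with
  | 0 => 1
  | k'.+1 => if k' is k''.+1 then
      x * hermite_rec k' x - k'%:R * hermite_rec k'' x else x
  end.

Lemma meval_hermite_var (R : realType) n (i : 'I_n) k (v : 'I_n -> R) :
  meval v (hermite_var R i k) = hermite_rec k (v i).
Proof.
elim/ltn_ind: k => -[_|[_|k IH]].
- by rewrite hermite_var0 meval1.
- by rewrite hermite_var1 mevalXU.
- by rewrite hermite_varSS mevalB mevalM mevalXU mevalZ !IH.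
Qed.

Lemma is_derive_hermite_rec (R : realType) k (x : R) :
  is_derive x (1 : R) (@hermite_rec R k) (k%:R * hermite_rec k.-1 x).
Proof.
elim/ltn_ind: k => -[_|[_|k IH]].
- by rewrite mul0r; exact: is_derive_cst.
- by rewrite mulr1; exact: is_derive_id.
- have h1 := IH k.+1 (ltnSn _); have h2 := IH k (ltnW (ltnSn _)).
  have h : is_derive x (1 : R) (fun y => y * hermite_rec k.+1 y - k.+1%:R * hermite_rec k y)
      (k.+2%:R * hermite_rec k.+2.-1 x).
    apply: is_derive_eq; rewrite /GRing.scale /=.
    case: k {IH h1 h2} => [|k] /=; first by ring.
    by rewrite -!natr1; ring.
  exact: h.
Qed.

(** One more derivative of the Gaussian factor produces [H_k' - x H_k], and [H_k' = k H_(k-1)] turns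
    this into [- H_(k+1)]. *)
Lemma derive1n_gaussian (R : realType) (k : nat) (x : R) :
  derive1n k (fun y : R => expR (- (y ^+ 2 / 2))) x =
  (-1) ^+ k * hermite_rec k x * expR (- (x ^+ 2 / 2)).
Proof.
elim: k x => [|k IH] x; first by rewrite expr0 mul1r /= mul1r.
rewrite derive1nS.
have -> : derive1n k (fun y : R => expR (- (y ^+ 2 / 2))) =
    (fun y => (-1) ^+ k * hermite_rec k y * expR (- (y ^+ 2 / 2))).
  by apply/funext => y; exact: IH.
have hk := is_derive_hermite_rec k x.
rewrite derive1E derive_val /GRing.scale /=.
case: k {IH hk} => [|k] /=; rewrite ?exprS; first by field.
by rewrite -?natr1; field.
Qed.

Lemma hermiteE (R : realType) (k : nat) (x : R) : hermite k x = hermite_rec k x.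
Proof.
rewrite /hermite derive1n_gaussian.
have sgn : (-1) ^+ k * (-1) ^+ k = 1 :> R by rewrite -exprMn mulrNN mulr1 expr1n.
have e : expR (x ^+ 2 / 2) * expR (- (x ^+ 2 / 2)) = 1 by rewrite -expRD subrr expR0.
transitivity (((-1) ^+ k * (-1) ^+ k)
  * (expR (x ^+ 2 / 2) * expR (- (x ^+ 2 / 2))) * hermite_rec k x); first by ring.
by rewrite sgn e !mul1r.
Qed.

Section IsonormalPolynomials.
Variables (R : realType) (H : completeNormedModType R) (dot : {dot H for idfun}).
Hypothesis dot_norm : forall h : H, dot h h = `|h| ^+ 2.
Variables (d : measure_display) (Omega : measurableType d) (P : probability Omega R).
Variables (X : H -> {RV P >-> R}) (X_isonormal : isonormal dot X).
Local Notation Ex := (Ex P).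
Local Notation integrableR := (integrableR P).
Local Notation has_moments := (has_moments P).

Let mfun_sumE n (F : 'I_n -> {mfun Omega >-> R}) (w : Omega) :
  (\sum_(j < n) F j : {mfun Omega >-> R}) w = \sum_(j < n) F j w.
Proof.
elim/big_ind2: _ => //= x1 x2 y1 y2 <- <-.
by [].
Qed.

Let linear_form_mgf n (h : 'I_n -> H) (a : 'I_n -> R) :
  exists s, gaussian_mgf P (fun w => \sum_j a j * X (h j) w) s.
Proof.
have [s hs] := isonormal_gaussian X_isonormal h a; exists s.
have := centered_normal_gaussian_mgf hs.
congr gaussian_mgf; apply/funext => w; rewrite mfun_sumE.
by apply: eq_bigr.
Qed.

Lemma has_moments_isonormal h : has_moments (X h).
Proof.
split; first exact: measurable_funPT.
have [s hs] := linear_form_mgf (fun _ : 'I_1 => h) (fun=> 1).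
apply: (@gaussian_mgf_integrable _ _ _ _ _ s); first exact: measurable_funPT.
by move=> t; rewrite -hs; apply: eq_integral => w _; rewrite big_ord1 mul1r.
Qed.

Lemma Ex_isonormalM g h : Ex (fun w => X g w * X h w) = dot g h.
Proof.
have := isonormal_covariance X_isonormal g h; rewrite expectationE.
  by move=> [].
by apply: has_moments_integrable; apply: has_momentsM; exact: has_moments_isonormal.
Qed.

Section FiniteFamily.
Variables (n : nat) (h : 'I_n -> H).
Local Notation poly := (mpoly n R).

Definition poly_rv (p : poly) (w : Omega) := meval (fun i => X (h i) w) p.

Definition poly_Ex (p : poly) := Ex (poly_rv p).

Lemma has_moments_poly p : has_moments (poly_rv p).
Proof. by apply: has_moments_meval => i; exact: has_moments_isonormal. Qed.

Let int_poly p : integrableR (poly_rv p).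
Proof. exact/has_moments_integrable/has_moments_poly. Qed.

Lemma poly_Ex_lin c p q : poly_Ex (c *: p + q) = c * poly_Ex p + poly_Ex q.
Proof.
rewrite /poly_Ex -ExZ// -ExD//; last exact: integrableRZ.
by apply: eq_Ex => w; rewrite /poly_rv mevalD mevalZ.
Qed.

Lemma poly_Ex1 : poly_Ex 1 = 1.
Proof. by rewrite -[RHS](Ex_cst P); apply: eq_Ex => w; rewrite /poly_rv meval1. Qed.

Lemma poly_Ex_ge0 p : (forall v, 0 <= meval v p) -> 0 <= poly_Ex p.
Proof. by move=> p0; apply: Ex_ge0 => w; exact: p0. Qed.

Variables (m : nat) (A : 'I_m -> 'I_n -> R).
Hypothesis hA : forall i j, dot (h i) (h j) = \sum_b A b i * A b j.

Let meval_linear_form (a v : 'I_n -> R) : meval v (linear_form a) = \sum_i a i * v i.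
Proof.
rewrite (raddf_sum (meval v)); apply: eq_bigr => i _.
by rewrite /= mevalZ mevalXU.
Qed.

Let poly_rv_linear (a : 'I_n -> R) w : poly_rv (linear_form a) w = \sum_j a j * X (h j) w.
Proof. exact: meval_linear_form. Qed.

Let poly_Ex_sum (I : Type) (r : seq I) (F : I -> poly) :
  poly_Ex (\sum_(i <- r) F i) = \sum_(i <- r) poly_Ex (F i).
Proof.
have ED p q : poly_Ex (p + q) = poly_Ex p + poly_Ex q.
  by rewrite -[p in LHS]scale1r poly_Ex_lin mul1r.
apply: (big_morph _ ED); apply: (@addrI _ (poly_Ex 0)).
by rewrite -ED !addr0.
Qed.

Let poly_EX2 i j : poly_Ex (mpolyX R (mnm1 i) * mpolyX R (mnm1 j)) = dot (h i) (h j).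
Proof.
by rewrite -Ex_isonormalM; apply: eq_Ex => w; rewrite /poly_rv mevalM !mevalXU.
Qed.

Let poly_Ex_linear_sqr (a : 'I_n -> R) : poly_Ex (linear_form a ^+ 2) = gram_quad A a.
Proof.
rewrite expr2 /linear_form mulr_suml poly_Ex_sum.
transitivity (\sum_i \sum_j \sum_b (A b i * a i) * (A b j * a j)).
  apply: eq_bigr => i _; rewrite mulr_sumr poly_Ex_sum; apply: eq_bigr => j _.
  rewrite -scalerAl -scalerAr scalerA -[_ *: _]addr0 poly_Ex_lin poly_EX2 hA.
  have -> : poly_Ex 0 = 0.
    by rewrite /poly_Ex -[RHS](Ex_cst P); apply: eq_Ex => w; rewrite /poly_rv meval0.
  by rewrite addr0 mulr_sumr; apply: eq_bigr => b _; ring.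
under eq_bigr do rewrite exchange_big /=.
rewrite exchange_big /= /gram_quad; apply: eq_bigr => b _.
by rewrite expr2 mulr_suml; apply: eq_bigr => i _; rewrite mulr_sumr.
Qed.

Lemma poly_Ex_ibp i p : poly_Ex (mpolyX R (mnm1 i) * p) = poly_Ex (delta A i p).
Proof.
have mY (a : 'I_n -> R) : measurable_fun [set: Omega] (fun w => \sum_j a j * X (h j) w).
  have [mp _] := has_moments_poly (linear_form a).
  rewrite (_ : (fun w => _) = poly_rv (linear_form a))//.
  by apply/funext => w; rewrite poly_rv_linear.
apply: gaussian_ibp i p.
- exact: poly_Ex_lin.
- move=> a; have [s hs] := linear_form_mgf h a.
  rewrite -(gaussian_mgf_mean (mY a) hs); apply: eq_Ex => w.
  exact: poly_rv_linear.
- move=> a k; have [s hs] := linear_form_mgf h a.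
  have powE j : poly_Ex (linear_form a ^+ j) =
      Ex (fun w => (\sum_i a i * X (h i) w) ^+ j).
    by apply: eq_Ex => w; rewrite /poly_rv rmorphXn /= meval_linear_form.
  (* The Gaussian hypothesis only provides some [s]; the second moment identifies [s ^+ 2] with
     [gram_quad A a]. *)
  have mom := gaussian_mgf_moment (mY a) hs.
  rewrite -poly_Ex_linear_sqr !powE !mom.
  suff -> : Ex (fun w => (\sum_j a j * X (h j) w) ^+ 0) = 1 by rewrite mul1r mulr1.
  by rewrite -[RHS](Ex_cst P); apply: eq_Ex => w; rewrite expr0.
Qed.
End FiniteFamily.

Variable q : nat.

Definition hermite_sum (f : Omega -> R) := exists (n : nat) (a : 'I_n -> R) (h : 'I_n -> H),
  (forall i, `|h i| = 1) /\
  f = (fun w => \sum_(i < n) a i * hermite q.+1 (X (h i) w)).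

Lemma hermite_sumZ c f : hermite_sum f -> hermite_sum (fun w => c * f w).
Proof.
move=> [n [a [h [hn ->]]]]; exists n, (fun i => c * a i), h; split => //.
by apply/funext => w; rewrite mulr_sumr; apply: eq_bigr => i _; rewrite mulrA.
Qed.

Let hermite_sum_poly f : hermite_sum f -> exists (n m : nat) (h : 'I_n -> H)
  (A : 'I_m -> 'I_n -> R) (p : mpoly n R),
  [/\ forall i j, dot (h i) (h j) = \sum_b A b i * A b j,
      chaos A q.+1 p, even_chaoses A q.+1.*2 (p ^+ 2) & f = poly_rv h p].
Proof.
move=> [n [a [h [hn ->]]]]; have [m [A hA]] := gram_factor dot_norm h.
exists n, m, h, A, (\sum_i a i *: hermite_var R i q.+1); split=> //.
(* Here [|h i| = 1] becomes the unit variance asked by [chaos_hermite_var]. *)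
- apply: chaos_sum => i _; apply/chaosZ/chaos_hermite_var.
  under eq_bigr do rewrite expr2.
  by rewrite -hA dot_norm hn expr1n.
- exact: (even_chaoses_hermite_sqr A a id).
- apply/funext => w; rewrite /poly_rv (raddf_sum (meval _)); apply: eq_bigr => i _.
  by rewrite /= mevalZ meval_hermite_var hermiteE.
Qed.

Lemma has_moments_hermite_sum f : hermite_sum f -> has_moments f.
Proof. by case/hermite_sum_poly => n [m [h [A [p [_ _ _ ->]]]]]; exact: has_moments_poly. Qed.

Let poly_Ex_pow n (h : 'I_n -> H) (p : mpoly n R) k :
  Ex (fun w => poly_rv h p w ^+ k) = poly_Ex h (p ^+ k).
Proof. by apply: eq_Ex => w; rewrite /poly_rv rmorphXn. Qed.

Lemma hermite_sum_hypercontractive f k : hermite_sum f ->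
  Ex (fun w => f w ^+ k.+1.*2) <=
  (k.*2.+1)%:R ^+ (q.+1 * k.+1) * Ex (fun w => f w ^+ 2) ^+ k.+1.
Proof.
case/hermite_sum_poly => n [m [h [A [p [hA hp _ ->]]]]]; rewrite !poly_Ex_pow.
apply: chaos_hypercontractive hp.
- exact: poly_Ex_lin.
- exact: poly_Ex1.
- exact: poly_Ex_ge0.
- exact: poly_Ex_ibp.
Qed.

Lemma hermite_sum_moment_gap f k : hermite_sum f -> Ex (fun w => f w ^+ 2) = 1 ->
  `|Ex (fun w => f w ^+ k.+3) - normal_moment R k.+3| <=
  k.+2%:R * (2 ^+ k * Num.sqrt ((k.+1.*2.-1)%:R ^+ (q.+1 * k.+1)) *
    Num.sqrt (q%:R / (3 * q.+1%:R) * (Ex (fun w => f w ^+ 4) - 3))).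
Proof.
case/hermite_sum_poly => n [m [h [A [p [hA hp ev ->]]]]]; rewrite !poly_Ex_pow => p2.
apply: (moment_gap _ _ _ _ hp p2 ev).
- exact: poly_Ex_lin.
- exact: poly_Ex1.
- exact: poly_Ex_ge0.
- exact: poly_Ex_ibp.
Qed.

End IsonormalPolynomials.

(** * Passage to the limit *)

Lemma norm_expr_double (R : realDomainType) (x : R) k : `|x| ^+ k.*2 = x ^+ k.*2.
Proof. by rewrite -!muln2 mulnC !exprM real_normK ?num_real. Qed.

(** The restriction [e <= 1 / 2] serves [normalized_approx], where it keeps the approximants away
    from 0. *)
Lemma le_small_param (R : realFieldType) (x y c : R) :
  (forall e, 0 < e -> e <= 1 / 2 -> x <= y + e * c) -> x <= y.
Proof.
move=> h; apply/ler_addgt0Pr => e e0.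
have c1 : 0 < `|c| + 1 by rewrite ltr_wpDl.
have m0 : 0 < Num.min (1 / 2) (e / (`|c| + 1)).
  by rewrite lt_min divr_gt0//= divr_gt0.
apply: (le_trans (h _ m0 _)); first by rewrite ge_min lexx.
rewrite lerD2l (@le_trans _ _ (e / (`|c| + 1) * (`|c| + 1)))//; last first.
  by rewrite divfK ?gt_eqF.
apply: (@le_trans _ _ (Num.min (1 / 2) (e / (`|c| + 1)) * (`|c| + 1))).
  by rewrite ler_pM2l// (le_trans (ler_norm c))// lerDl.
by rewrite ler_pM2r// ge_min lexx orbT.
Qed.

(** [x] may be negative, since the sign of [E Z^4 - 3] is never established separately. *)
Lemma sqrtr_subadditive (R : rcfType) (x y : R) : 0 <= y ->
  Num.sqrt (x + y) <= Num.sqrt x + Num.sqrt y.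
Proof.
move=> y0; have [x0|x0] := leP 0 x; last first.
  by rewrite (ltr0_sqrtr x0) add0r; apply: ler_wsqrtr; rewrite gerDr ltW.
rewrite -[leRHS]ger0_norm ?addr_ge0 ?sqrtr_ge0// -sqrtr_sqr.
apply: ler_wsqrtr; rewrite sqrrD !sqr_sqrtr// lerD2r lerDl.
by rewrite mulrn_wge0// mulr_ge0 ?sqrtr_ge0.
Qed.

(* The right-hand side involves [z] only through [`|z - y|], so an L^2
   approximation controls the high moments of the truncation of its limit. *)
Lemma pow_min_le (R : realFieldType) (n : nat) (z y M : R) : 0 <= M ->
  Num.min `|z| M ^+ n.+1 <= `|y| ^+ n.+1 + n.+1%:R * M ^+ n * `|z - y|.
Proof.
move=> M0; set u := Num.min _ _.
have u0 : 0 <= u by rewrite le_min normr_ge0.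
have uz : u <= `|y| + `|z - y|.
  apply: (@le_trans _ _ `|z|); first by rewrite ge_min lexx.
  by rewrite -{1}[z](subrK y) addrC ler_normD.
have uM : u ^+ n <= M ^+ n.
  by apply: lerXn2r; rewrite ?nnegrE// ge_min lexx orbT.
have := young_pow n u0 (normr_ge0 y).
have h1 : u ^+ n.+1 <= u ^+ n * `|y| + u ^+ n * `|z - y|.
  by rewrite exprSr -mulrDr ler_wpM2l// exprn_ge0.
have h2 : u ^+ n * `|z - y| <= M ^+ n * `|z - y| by rewrite ler_wpM2r.
have h3 : u ^+ n.+1 <= u ^+ n * `|y| + M ^+ n * `|z - y| by lra.
have := ler_wpM2l (ler0n R n.+1) h3.
rewrite mulrDr -[in X in X <= _ -> _]natr1 mulrDl mul1r mulrA; lra.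
Qed.

Lemma norm_subXX_le (R : realDomainType) (x y : R) (j : nat) :
  `|x ^+ j.+1 - y ^+ j.+1| <= `|x - y| * (j.+1%:R * (`|x| ^+ j + `|y| ^+ j)).
Proof.
rewrite subrXX normrM ler_wpM2l// (le_trans (ler_norm_sum _ _ _))//.
rewrite -[in leRHS](card_ord j.+1) mulr_natl -sumr_const.
apply: ler_sum => i _; rewrite /= normrM !normrX.
have ij : (i <= j)%N by rewrite -ltnS.
have /orP[xy|xy] := le_total `|x| `|y|.
  apply: (@le_trans _ _ (`|y| ^+ j)); last by rewrite lerDr exprn_ge0.
  rewrite -[in leRHS](subnK ij) exprD ler_wpM2r ?exprn_ge0//.
  by apply: lerXn2r; rewrite ?nnegrE.
apply: (@le_trans _ _ (`|x| ^+ j)); last by rewrite lerDl exprn_ge0.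
rewrite -[in leRHS](subnK ij) exprD ler_wpM2l ?exprn_ge0//.
by apply: lerXn2r; rewrite ?nnegrE.
Qed.

Section MomentLimit.
Context d (Omega : measurableType d) (R : realType) (P : probability Omega R).
Implicit Types f g : Omega -> R.
Local Notation integrableR := (integrableR P).
Local Notation Ex := (Ex P).
Local Notation has_moments := (has_moments P).

Definition square_integrable f := measurable_fun [set: Omega] f /\
  integrableR (fun w => f w ^+ 2).

Lemma square_integrableM f g : square_integrable f -> square_integrable g ->
  integrableR (fun w => f w * g w).
Proof.
move=> [mf hf] [mg hg].
apply: (integrableR_le _ _ (integrableRD hf hg)); first exact: measurable_funM.
move=> w; rewrite ler_norml; have := sqr_ge0 (f w + g w); have := sqr_ge0 (f w - g w).
by have := sqr_ge0 (f w); have := sqr_ge0 (g w); move=> *; apply/andP; split; nra.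
Qed.

Lemma Ex_sqrD f g t : square_integrable f -> square_integrable g ->
  Ex (fun w => (f w + t * g w) ^+ 2) =
  Ex (fun w => f w ^+ 2) + 2 * Ex (fun w => f w * g w) * t + Ex (fun w => g w ^+ 2) * t ^+ 2.
Proof.
move=> hf hg; have hfg := square_integrableM hf hg.
have [mf hf2] := hf; have [mg hg2] := hg.
transitivity (Ex (fun w => (f w ^+ 2 + (2 * t) * (f w * g w)) + t ^+ 2 * g w ^+ 2)).
  by apply: eq_Ex => w; ring.
rewrite !ExD ?ExZ//; first by ring.
- exact: integrableRZ.
- by apply: integrableRD => //; exact: integrableRZ.
- exact: integrableRZ.
Qed.

Lemma Ex_CauchySchwarz f g : square_integrable f -> square_integrable g ->
  Ex (fun w => f w * g w) ^+ 2 <= Ex (fun w => f w ^+ 2) * Ex (fun w => g w ^+ 2).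
Proof.
move=> hf hg; apply: discriminant_le => t; rewrite -Ex_sqrD//.
by apply: Ex_ge0 => w; exact: sqr_ge0.
Qed.

Lemma square_integrableD f g : square_integrable f -> square_integrable g ->
  square_integrable (fun w => f w + g w).
Proof.
move=> [mf hf] [mg hg]; split; first exact: measurable_funD.
apply: (integrableR_le _ _ (integrableRZ 2 (integrableRD hf hg))).
  by apply: measurable_funX; exact: measurable_funD.
move=> w; rewrite ger0_norm ?sqr_ge0//; have := sqr_ge0 (f w - g w); nra.
Qed.

Lemma square_integrableZ c f : square_integrable f ->
  square_integrable (fun w => c * f w).
Proof.
move=> [mf hf]; split; first exact: measurable_funM.
by under eq_fun do rewrite exprMn; exact: integrableRZ.
Qed.

Lemma square_integrable_norm f : square_integrable f ->
  square_integrable (fun w => `|f w|).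
Proof.
move=> [mf hf]; split; first exact: measurableT_comp.
by under eq_fun do rewrite real_normK ?num_real//.
Qed.

Lemma has_moments_square_integrable f : has_moments f -> square_integrable f.
Proof.
move=> hf; split; first exact: hf.1.
exact/has_moments_integrable/has_momentsX.
Qed.

Lemma square_integrable_integrable f : square_integrable f -> integrableR f.
Proof.
move=> hf; have h1 := has_moments_square_integrable (has_moments_cst P 1).
have := square_integrableM hf h1.
by under eq_fun do rewrite mulr1.
Qed.

Variables (C : set (Omega -> R)) (K : nat -> R).
Hypothesis C_moments : forall f, C f -> has_moments f.
Hypothesis CZ : forall c f, C f -> C (fun w => c * f w).
Hypothesis C_bound : forall f k, C f -> Ex (fun w => f w ^+ 2) = 1 ->
  Ex (fun w => f w ^+ k.+1.*2) <= K k.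
Variable Z : Omega -> R.
Hypothesis Z_square : square_integrable Z.
Hypothesis Z1 : Ex (fun w => Z w ^+ 2) = 1.
Hypothesis Z_approx : forall e, 0 < e -> exists2 f, C f &
  Ex (fun w => (Z w - f w) ^+ 2) <= e ^+ 2.

(** The moment bounds concern unit elements, so [f] is divided by its norm [s]. Cauchy-Schwarz gives
    [(1 - s)^2 <= e^2], hence [s >= 1/2]; then the squared distance [2 (s - b) / s] is at most
    [e^2 / s <= 2 e^2]. *)
Lemma normalized_approx e : 0 < e -> e <= 1 / 2 -> exists g,
  [/\ C g, Ex (fun w => g w ^+ 2) = 1 & Ex (fun w => (Z w - g w) ^+ 2) <= 2 * e ^+ 2].
Proof.
move=> e0 e2; have [f Cf hf] := Z_approx e0.
have sf := has_moments_square_integrable (C_moments Cf).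
set v := Ex (fun w => f w ^+ 2); set b := Ex (fun w => Z w * f w).
have dist t : Ex (fun w => (Z w + t * f w) ^+ 2) = 1 + 2 * b * t + v * t ^+ 2.
  by rewrite Ex_sqrD// Z1.
have v0 : 0 <= v by apply: Ex_ge0 => w; exact: sqr_ge0.
pose s := Num.sqrt v.
have s0 : 0 <= s by exact: sqrtr_ge0.
have vs : v = s ^+ 2 by rewrite sqr_sqrtr.
have bs : b <= s.
  have := Ex_CauchySchwarz Z_square sf; rewrite Z1 mul1r -/v -/b vs => h.
  apply: (le_trans (ler_norm b)); rewrite -(ger0_norm s0).
  by rewrite -ler_sqr ?nnegrE// !real_normK ?num_real.
have hD : 1 - 2 * b + v <= e ^+ 2.
  apply: le_trans hf; rewrite le_eqVlt; apply/orP; left; apply/eqP.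
  transitivity (Ex (fun w => (Z w + (-1) * f w) ^+ 2)); first by rewrite dist; ring.
  by apply: eq_Ex => w; rewrite mulN1r.
have s12 : 1 / 2 <= s.
  rewrite leNgt; apply/negP => sl; rewrite vs in hD.
  have : 0 < (1 - s - e) * (1 - s + e) by rewrite mulr_gt0//; lra.
  move=> h; nra.
have sN0 : s != 0 by rewrite gt_eqF//; lra.
have si : 0 < s^-1 by rewrite invr_gt0; lra.
exists (fun w => s^-1 * f w); split; first exact: CZ.
  under eq_Ex do rewrite exprMn.
  by rewrite ExZ ?sf.2// -/v vs -exprMn mulVf// expr1n.
have -> : Ex (fun w => (Z w - s^-1 * f w) ^+ 2) = 1 + 2 * b * (- s^-1) + v * (- s^-1) ^+ 2.
  by rewrite -dist; apply: eq_Ex => w; rewrite mulNr.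
have -> : 1 + 2 * b * (- s^-1) + v * (- s^-1) ^+ 2 = 2 * (s - b) * s^-1.
  by rewrite vs; field.
rewrite ler_pdivrMr; last by lra.
rewrite vs in hD; have h1 := sqr_ge0 (1 - s).
have h2 : 0 <= e ^+ 2 * (2 * s - 1) by rewrite mulr_ge0 ?sqr_ge0//; lra.
nra.
Qed.

Let Ex_norm_sub g e : square_integrable g -> 0 < e ->
  Ex (fun w => (Z w - g w) ^+ 2) <= 2 * e ^+ 2 ->
  Ex (fun w => `|Z w - g w|) <= 2 * e.
Proof.
move=> sg e0 hg.
have sZg : square_integrable (fun w => `|Z w - g w|).
  apply: square_integrable_norm.
  have := square_integrableD Z_square (square_integrableZ (-1) sg).
  by under eq_fun do rewrite mulN1r.
have := Ex_CauchySchwarz sZg (has_moments_square_integrable (has_moments_cst P 1)).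
under eq_Ex do rewrite mulr1.
under [X in _ <= X * _ -> _]eq_Ex do rewrite real_normK ?num_real//.
under [X in _ <= _ * X -> _]eq_Ex do rewrite expr1n.
rewrite Ex_cst mulr1 => h.
have E0 : 0 <= Ex (fun w => `|Z w - g w|) by apply: Ex_ge0.
rewrite -ler_sqr ?nnegrE//; last by lra.
by nra.
Qed.

Let truncated_moment k (M : R) : 0 <= M ->
  Ex (fun w => Num.min `|Z w| M ^+ k.+1.*2) <= K k.
Proof.
(* For fixed [M] the error in [pow_min_le] is linear in the L^1 distance and vanishes with [e],
   however large its coefficient. *)
move=> M0; apply: (@le_small_param _ _ _ (k.+1.*2%:R * M ^+ k.*2.+1 * 2)) => e e0 e2.
have [g [Cg g1 hg]] := normalized_approx e0 e2.
have sg := has_moments_square_integrable (C_moments Cg).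
have sZg : square_integrable (fun w => `|Z w - g w|).
  apply: square_integrable_norm.
  have := square_integrableD Z_square (square_integrableZ (-1) sg).
  by under eq_fun do rewrite mulN1r.
have iZg := square_integrable_integrable sZg.
have ig : integrableR (fun w => g w ^+ k.+1.*2).
  exact/has_moments_integrable/has_momentsX/C_moments.
have pt w : Num.min `|Z w| M ^+ k.+1.*2 <=
    g w ^+ k.+1.*2 + k.+1.*2%:R * M ^+ k.*2.+1 * `|Z w - g w|.
  apply: (le_trans (pow_min_le _ _ (g w) M0)).
  by have := norm_expr_double (g w) k.+1 => /= ->.
have irhs : integrableR (fun w => g w ^+ k.+1.*2 + k.+1.*2%:R * M ^+ k.*2.+1 * `|Z w - g w|).
  by apply: integrableRD => //; exact: integrableRZ.
have mmin : measurable_fun [set: Omega] (fun w => Num.min `|Z w| M ^+ k.+1.*2).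
  apply: measurable_funX; apply: measurable_minr; last exact: measurable_cst.
  by apply: measurableT_comp => //; exact: Z_square.1.
have min0 w : 0 <= Num.min `|Z w| M ^+ k.+1.*2.
  by rewrite exprn_ge0// le_min normr_ge0.
have imin : integrableR (fun w => Num.min `|Z w| M ^+ k.+1.*2).
  by apply: (integrableR_le mmin _ irhs) => w; rewrite ger0_norm.
apply: (le_trans (Ex_le imin irhs pt)); rewrite ExD ?ExZ//; last exact: integrableRZ.
apply: lerD; first exact: C_bound.
rewrite [leRHS](_ : _ = k.+1.*2%:R * M ^+ k.*2.+1 * (2 * e)); last by ring.
by apply: ler_wpM2l; [rewrite mulr_ge0 ?exprn_ge0|exact: Ex_norm_sub].
Qed.

(** The bound on truncated moments does not depend on the level, so monotone convergence removes the
    truncation. *)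
Lemma limit_moment k : integrableR (fun w => Z w ^+ k.+1.*2) /\
  Ex (fun w => Z w ^+ k.+1.*2) <= K k.
Proof.
pose f (n : nat) w : \bar R := (Num.min `|Z w| n%:R ^+ k.+1.*2)%:E.
have Zpow w : `|Z w| ^+ k.+1.*2 = Z w ^+ k.+1.*2 by exact: norm_expr_double.
have mf n : measurable_fun [set: Omega] (f n).
  apply/measurable_EFinP; apply: measurable_funX; apply: measurable_minr => //.
  by apply: measurableT_comp => //; exact: Z_square.1.
have f0 n w : (0 <= f n w)%E by rewrite lee_fin exprn_ge0// le_min normr_ge0 ler0n.
have f_nd w (i j : nat) : (i <= j)%N -> (f i w <= f j w)%E.
  move=> ij; rewrite lee_fin; apply: lerXn2r; rewrite ?nnegrE ?le_min ?normr_ge0//=.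
  by rewrite ge_min lexx /= ge_min ler_nat ij orbT.
have f_cvg w : f n w @[n --> \oo] --> (Z w ^+ k.+1.*2)%:E.
  apply: (@cvg_near_cst _ _ _ _ _ _ _).
  near=> n; rewrite /f; congr EFin; rewrite -Zpow; congr (_ ^+ _).
  apply/min_idPl; near: n; exact: nbhs_infty_ger.
have intf n : (\int[P]_w f n w <= (K k)%:E)%E.
  have mn : integrableR (fun w => Num.min `|Z w| n%:R ^+ k.+1.*2).
    apply: (integrableR_le _ _ (integrableR_cst P (n%:R ^+ k.+1.*2))).
      by apply/measurable_EFinP; exact: mf.
    move=> w; rewrite ger0_norm; last by rewrite exprn_ge0// le_min normr_ge0 ler0n.
    by apply: lerXn2r; rewrite ?nnegrE ?le_min ?normr_ge0//= ?ge_min ?lexx ?orbT.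
  have := truncated_moment k (ler0n R n).
  by rewrite -lee_fin -expectationE// unlock.
have mZ : measurable_fun [set: Omega] (fun w => Z w ^+ k.+1.*2).
  by apply: measurable_funX; exact: Z_square.1.
have Z0 w : 0 <= Z w ^+ k.+1.*2 by rewrite -Zpow exprn_ge0.
have bound : (\int[P]_w (Z w ^+ k.+1.*2)%:E <= (K k)%:E)%E.
  have := @cvg_monotone_convergence _ _ _ P _ measurableT f mf
    (fun n w _ => f0 n w) (fun w _ => f_nd w).
  have -> : (\int[P]_w limn (f ^~ w) = \int[P]_w (Z w ^+ k.+1.*2)%:E)%E.
    by apply: eq_integral => w _; apply/cvg_lim => //; exact: f_cvg.
  move=> h; rewrite -(cvg_lim _ h)//; apply: lime_le; first exact: (cvgP _ h).
  by apply: nearW => n; exact: intf.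
have iZ : integrableR (fun w => Z w ^+ k.+1.*2) := integrableR_ge0 mZ Z0 bound.
by split=> //; rewrite -lee_fin -expectationE// unlock.
Unshelve. all: by end_near. Qed.

Lemma has_moments_limit : has_moments Z.
Proof.
split=> [|k]; first exact: Z_square.1.
have [iZ _] := limit_moment k.
apply: (integrableR_le _ _ (integrableRD (integrableR_cst P 1) iZ)).
  by apply: measurable_funX; apply: measurableT_comp => //; exact: Z_square.1.
move=> w; rewrite normrX normr_id.
rewrite -norm_expr_double.
have [z1|z1] := leP `|Z w| 1.
  apply: (@le_trans _ _ 1); last by rewrite lerDl exprn_ge0.
  by rewrite exprn_ile1.
apply: (@le_trans _ _ (`|Z w| ^+ k.+1.*2)); last by rewrite lerDr.
by rewrite ler_weXn2l ?(ltW z1)//; lia.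
Qed.

Let moment_distance j : exists2 D : R, 0 <= D &
  forall e g, 0 < e -> C g -> Ex (fun w => g w ^+ 2) = 1 ->
    Ex (fun w => (Z w - g w) ^+ 2) <= 2 * e ^+ 2 ->
    `|Ex (fun w => Z w ^+ j.+1) - Ex (fun w => g w ^+ j.+1)| <= e * D.
Proof.
(* The outer 2 comes from [2 * e ^+ 2], the inner one from [(x + y)^2 <= 2 (x^2 + y^2)], and
   [1 + K j] from [|g|^(2j) <= 1 + g^(2j+2)]. *)
pose B := 2 * (j.+1%:R ^+ 2 * (2 * (Ex (fun w => `|Z w| ^+ j.*2) + (1 + K j)))).
exists (Num.sqrt B) => [|e g e0 Cg g1 hg]; first exact: sqrtr_ge0.
have hZ := has_moments_limit; have hgm := C_moments Cg.
have mZg : has_moments (fun w => `|Z w - g w|).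
  exact/has_moments_norm/has_momentsB.
pose W w := j.+1%:R * (`|Z w| ^+ j + `|g w| ^+ j).
have mW : has_moments W.
  by apply: has_momentsZ; apply: has_momentsD; apply: has_momentsX; exact: has_moments_norm.
have iX f k : has_moments f -> integrableR (fun w => f w ^+ k).
  by move=> hf; exact/has_moments_integrable/has_momentsX.
have -> : Ex (fun w => Z w ^+ j.+1) - Ex (fun w => g w ^+ j.+1) =
    Ex (fun w => Z w ^+ j.+1 + (-1) * g w ^+ j.+1).
  have i1 := iX _ j.+1 hZ; have i2 := iX _ j.+1 hgm.
  by rewrite ExD ?ExZ ?mulN1r//; exact: integrableRZ.
have le1 : `|Ex (fun w => Z w ^+ j.+1 + (-1) * g w ^+ j.+1)| <=
    Ex (fun w => `|Z w - g w| * W w).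
  have i1 : integrableR (fun w => Z w ^+ j.+1 + (-1) * g w ^+ j.+1).
    by apply: integrableRD; [exact: iX|apply: integrableRZ; exact: iX].
  have i2 : integrableR (fun w => `|Z w - g w| * W w).
    exact/has_moments_integrable/has_momentsM.
  have pt w : `|Z w ^+ j.+1 + (-1) * g w ^+ j.+1| <= `|Z w - g w| * W w.
    by rewrite mulN1r; exact: norm_subXX_le.
  rewrite ler_norml; apply/andP; split.
    rewrite lerNl -[leLHS]mulN1r -ExZ//; apply: Ex_le => //; first exact: integrableRZ.
    by move=> w; rewrite [leLHS]mulN1r lerNl; have := pt w; rewrite ler_norml => /andP[].
  by apply: Ex_le => // w; exact: le_trans (ler_norm _) (pt w).
apply: (le_trans le1).
have E0 : 0 <= Ex (fun w => `|Z w - g w| * W w).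
  by apply: Ex_ge0 => w; rewrite !mulr_ge0// addr_ge0// exprn_ge0.
have cs := Ex_CauchySchwarz (has_moments_square_integrable mZg)
  (has_moments_square_integrable mW).
rewrite -(ger0_norm E0) -sqrtr_sqr.
have -> : e * Num.sqrt B = Num.sqrt (e ^+ 2 * B).
  by rewrite [RHS]sqrtrM ?sqr_ge0// sqrtr_sqr gtr0_norm.
apply: ler_wsqrtr; apply: (le_trans cs).
have -> : e ^+ 2 * B = (2 * e ^+ 2) * (B / 2) by field.
apply: ler_pM; try by apply: Ex_ge0 => w; exact: sqr_ge0.
  by under eq_Ex do rewrite real_normK ?num_real//.
have -> : B / 2 = j.+1%:R ^+ 2 * (2 * (Ex (fun w => `|Z w| ^+ j.*2) + (1 + K j))).
  by rewrite /B; field.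
have iZ2 : integrableR (fun w => `|Z w| ^+ j.*2) by apply: iX; exact: has_moments_norm.
have ig2 : integrableR (fun w => `|g w| ^+ j.*2) by apply: iX; exact: has_moments_norm.
apply: (@le_trans _ _
  (Ex (fun w => j.+1%:R ^+ 2 * (2 * (`|Z w| ^+ j.*2 + `|g w| ^+ j.*2))))).
  apply: Ex_le; first exact: iX.
    by do 2! apply: integrableRZ; exact: integrableRD.
  move=> w; rewrite /W exprMn ler_wpM2l ?sqr_ge0// -!muln2 !exprM.
  by have := sqr_ge0 (`|Z w| ^+ j - `|g w| ^+ j); nra.
rewrite !ExZ ?ExD//; last 2 first.
- exact: integrableRD.
- by apply: integrableRZ; exact: integrableRD.
rewrite ler_wpM2l ?sqr_ge0// ler_wpM2l// lerD2l.
have ig3 : integrableR (fun w => g w ^+ j.+1.*2) by exact: iX.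
apply: (@le_trans _ _ (Ex (fun w => 1 + g w ^+ j.+1.*2))).
  apply: Ex_le => //; first by apply: integrableRD => //; exact: integrableR_cst.
  move=> w; rewrite -[g w ^+ _]norm_expr_double.
  have [z1|z1] := leP `|g w| 1.
    apply: (@le_trans _ _ 1); last by rewrite lerDl exprn_ge0.
    by rewrite exprn_ile1.
  apply: (@le_trans _ _ (`|g w| ^+ j.+1.*2)); last by rewrite lerDr.
  by rewrite ler_weXn2l ?(ltW z1)//; lia.
rewrite ExD//; last exact: integrableR_cst.
by rewrite Ex_cst lerD2l; exact: C_bound.
Qed.

Lemma limit_moment_gap j (b c mu : R) : 0 <= b -> 0 <= c ->
  (forall g, C g -> Ex (fun w => g w ^+ 2) = 1 ->
    `|Ex (fun w => g w ^+ j.+1) - mu| <=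
    c * Num.sqrt (b * (Ex (fun w => g w ^+ 4) - 3))) ->
  `|Ex (fun w => Z w ^+ j.+1) - mu| <=
  c * Num.sqrt (b * (Ex (fun w => Z w ^+ 4) - 3)).
Proof.
move=> b0 c0 gap.
have [D D0 hD] := moment_distance j; have [D4 D40 hD4] := moment_distance 3.
apply: (@le_small_param _ _ _ (D + c * Num.sqrt (b * D4))) => e e0 e2.
(* Approximation at scale [e ^+ 2]: the square root turns the error in the fourth moment into a
   multiple of [e]. *)
have ee0 : 0 < e ^+ 2 by rewrite exprn_gt0.
have eee : e ^+ 2 <= e by nra.
have [g [Cg g1 hg]] := normalized_approx ee0 (le_trans eee e2).
have h1 := hD _ _ ee0 Cg g1 hg; have h4 := hD4 _ _ ee0 Cg g1 hg.
have hgap := gap _ Cg g1.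
have hs : Num.sqrt (b * (Ex (fun w => g w ^+ 4) - 3)) <=
    Num.sqrt (b * (Ex (fun w => Z w ^+ 4) - 3)) + e * Num.sqrt (b * D4).
  have -> : e * Num.sqrt (b * D4) = Num.sqrt (b * (e ^+ 2 * D4)).
    by rewrite mulrCA [in RHS]sqrtrM ?sqr_ge0// sqrtr_sqr gtr0_norm.
  apply: le_trans (sqrtr_subadditive _ _); last first.
    by apply: mulr_ge0 => //; apply: mulr_ge0 => //; exact: sqr_ge0.
  apply: ler_wsqrtr; rewrite -mulrDr ler_wpM2l//.
  by move: h4; rewrite ler_norml => /andP[]; lra.
rewrite -[X in X - mu](subrK (Ex (fun w => g w ^+ j.+1))) -addrA.
apply: (le_trans (ler_normD _ _)).
have := ler_wpM2l c0 hs; have := ler_wpM2r D0 eee; lra.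
Qed.

End MomentLimit.

(** * The constant, and the conclusion *)

Lemma moment_constant_ge (R : realType) (j q : nat) :
  j.+2%:R * (2 ^+ j * Num.sqrt ((j.+1.*2.-1)%:R ^+ (q.+1 * j.+1)))
    * Num.sqrt (q%:R / (3 * q.+1%:R)) <= moment_constant R j.+3 q.+1.
Proof.
rewrite /moment_constant.
have e3 : j.+3%:R = j%:R + 3 :> R by rewrite -addn3 natrD.
have -> : j.+3%:R - 1 = j.+2%:R :> R by rewrite -[j.+3%:R]natr1 addrK.
have -> : q.+1%:R - 1 = q%:R :> R by rewrite -natr1 addrK.
have e5 : 2 * j.+3%:R - 5 = (j.+1.*2.-1)%:R :> R.
  rewrite (_ : j.+1.*2.-1 = j.*2.+1)%N; last by lia.
  have -> : j.*2.+1%:R = j%:R * 2 + 1 :> R by rewrite -natr1 -muln2 natrM.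
  by rewrite e3; ring.
(* With [k = j + 3] this is [2^(k-3) <= 2^(k-5/2)]. *)
have pow2 : 2 ^+ j <= 2 `^ (j.+3%:R - 5 / 2) :> R.
  rewrite -powR_mulrn// ler_powR ?ler1n//.
  by rewrite e3; lra.
have pow_sqrt : Num.sqrt ((j.+1.*2.-1)%:R ^+ (q.+1 * j.+1)) =
    (2 * j.+3%:R - 5) `^ (j.+3%:R * q.+1%:R / 2 - q.+1%:R) :> R.
  rewrite e5 -powR12_sqrt ?exprn_ge0// -powR_mulrn// -powRrM; congr (_ `^ _).
  have e1 : j.+1%:R = j%:R + 1 :> R by rewrite natr1.
  by rewrite natrM e3 e1; field.
rewrite pow_sqrt mulrA mulrAC.
apply: ler_pM.
- by rewrite !mulr_ge0// sqrtr_ge0.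
- exact: powR_ge0.
- by rewrite ler_wpM2r ?sqrtr_ge0// ler_wpM2l.
- by rewrite lerDr sqrtr_ge0.
Qed.

Lemma normal_moments (R : realType) (d : measure_display)
  (Omega : measurableType d) (P : probability Omega R) (N : {RV P >-> R}) k :
  has_law N (normal_prob 0 1) ->
  has_moments P N /\ Ex P (fun w => N w ^+ k) = normal_moment R k.
Proof.
move=> Nlaw; have mN : measurable_fun [set: Omega] N by exact: measurable_funPT.
have mgf : gaussian_mgf P N 1 by apply: normal_gaussian_mgf => //; exact: oner_neq0.
split; first by split => // j; exact: (gaussian_mgf_integrable mN mgf).
elim/ltn_ind: k => -[_|[_|k IH]].
- by rewrite -[RHS](Ex_cst P).
- by rewrite /= -(gaussian_mgf_mean mN mgf).
- by rewrite (gaussian_mgf_moment mN mgf) expr1n mulr1 IH.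
Qed.

Lemma Lnorm2_lt_sqr (R : realType) (d : measure_display)
  (Omega : measurableType d) (P : probability Omega R) (f : Omega -> R) e :
  integrableR P (fun w => f w ^+ 2) -> 0 <= e ->
  ('N[P]_2%:E[EFin \o f] < e%:E)%E -> Ex P (fun w => f w ^+ 2) <= e ^+ 2.
Proof.
move=> hf e0 Nf; rewrite -lee_fin -expectationE// unlock.
have -> : (\int[P]_w (f w ^+ 2)%:E = \int[P]_w `|(EFin \o f) w| `^ 2)%E.
  apply: eq_integral => w _; rewrite /comp abse_EFin poweR_EFin powR_mulrn//.
  by rewrite real_normK ?num_real.
rewrite -poweR_Lnorm//.
have -> : ((e ^+ 2)%:E = e%:E `^ 2)%E by rewrite poweR_EFin powR_mulrn.
apply: gt0_ler_poweR => //; last exact: ltW.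
- by rewrite in_itv /= Lnorm_ge0 leey.
- by rewrite in_itv /= lee_fin e0 leey.
Qed.

Unset Implicit Arguments.

Theorem proposition3p14 (R : realType)
  (H : completeNormedModType R) (dot : {dot H for idfun})
  (dot_norm : forall h : H, dot h h = `|h| ^+ 2)
  (H_separable : separable H)
  (d : measure_display) (Omega : measurableType d) (P : probability Omega R)
  (X : H -> {RV P >-> R}) (X_isonormal : isonormal dot X)
  (q : nat) (q_ge2 : (2 <= q)%N)
  (Z : {RV P >-> R}) (Z_chaos : wiener_chaos X q Z)
  (Z_var : 'V_P[Z] = 1%E) (Z_sqr : ('E_P[(fun w => (Z w ^+ 2)%R)] = 1)%E)
  (d' : measure_display) (Omega' : measurableType d')
  (P' : probability Omega' R)
  (N : {RV P' >-> R}) (N_normal : has_law N (normal_prob 0 1))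
  (k : nat) (k_ge3 : (3 <= k)%N) :
  (`| 'E_P[(fun w => (Z w ^+ k)%R)] - 'E_P'[(fun w => (N w ^+ k)%R)] |
   <= (moment_constant R k q)%:E *
      sqrte ('E_P[(fun w => (Z w ^+ 4)%R)] - 'E_P'[(fun w => (N w ^+ 4)%R)]))%E.
Proof.
(* From here the order of the chaos is [q.+1] and, below, the order of the moment is [j.+3]. *)
case: q q_ge2 Z_chaos => [//|q] _ Z_chaos.
case: k k_ge3 => [|[|[|j]]] // _.
have [Z_Lfun Z_approx] := Z_chaos.
have sZ : square_integrable P Z.
  split; first exact: measurable_funPT.
  exact: Lfun2_integrable_sqr Z_Lfun.
have Z1 : Ex P (fun w => Z w ^+ 2) = 1.
  by have := Z_sqr; rewrite expectationE ?sZ.2// => -[].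
pose C := @hermite_sum R H d Omega P X q.
have C_moments f : C f -> has_moments P f.
  exact: (has_moments_hermite_sum dot_norm X_isonormal).
pose K (i : nat) : R := (i.*2.+1)%:R ^+ (q.+1 * i.+1).
have C_bound f i : C f -> Ex P (fun w => f w ^+ 2) = 1 ->
    Ex P (fun w => f w ^+ i.+1.*2) <= K i.
  move=> Cf f1; have := hermite_sum_hypercontractive dot_norm X_isonormal i Cf.
  by rewrite f1 expr1n mulr1.
have CZ c f : C f -> C (fun w => c * f w) by exact: hermite_sumZ.
have Z_approx2 e : 0 < e -> exists2 f, C f &
    Ex P (fun w => (Z w - f w) ^+ 2) <= e ^+ 2.
  move=> e0; have [n [a [h [hn hZ]]]] := Z_approx e e0.
  have Cf : C (fun w => \sum_(i < n) a i * hermite q.+1 (X (h i) w)).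
    by exists n, a, h.
  eexists; first exact: Cf.
  apply: Lnorm2_lt_sqr (ltW e0) hZ.
  have := square_integrableD sZ
    (square_integrableZ (-1) (has_moments_square_integrable (C_moments _ Cf))).
  by move=> [_]; under eq_fun do rewrite mulN1r.
have Z_moments : has_moments P Z.
  exact: (has_moments_limit C_moments CZ C_bound sZ Z1 Z_approx2).
have iZ i : integrableR P (fun w => Z w ^+ i).
  exact/has_moments_integrable/has_momentsX.
have iN i : integrableR P' (fun w => N w ^+ i).
  apply/has_moments_integrable/has_momentsX.
  exact: (@normal_moments _ _ _ _ N i N_normal).1.
rewrite !expectationE// !(@normal_moments _ _ _ _ N _ N_normal).2 -!EFinB abse_EFin /= -EFinM.
rewrite lee_fin.
pose b : R := q%:R / (3 * q.+1%:R).
pose c : R := j.+2%:R * (2 ^+ j * Num.sqrt ((j.+1.*2.-1)%:R ^+ (q.+1 * j.+1))).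
have b0 : 0 <= b by rewrite divr_ge0.
have c0 : 0 <= c by rewrite !mulr_ge0// sqrtr_ge0.
have gap g : C g -> Ex P (fun w => g w ^+ 2) = 1 ->
    `|Ex P (fun w => g w ^+ j.+3) - normal_moment R j.+3| <=
    c * Num.sqrt (b * (Ex P (fun w => g w ^+ 4) - 3)).
  move=> Cg g1; rewrite /c -mulrA.
  exact: (hermite_sum_moment_gap dot_norm X_isonormal j Cg g1).
have := limit_moment_gap C_moments CZ C_bound sZ Z1 Z_approx2 b0 c0 gap.
(* [normal_moment R 4] evaluates to 3, and the factor [Num.sqrt b] joins the constant. *)
rewrite sqrtrM// => /le_trans; apply; rewrite /= !mulr1 mulrA.
by rewrite ler_wpM2r ?sqrtr_ge0//; exact: moment_constant_ge.
Qed.
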